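(* Let $1<q<p<\infty$. Let $X$ be an infinite dimensional Banach space with the $q$-co-Banach-Saks property and let $Y$ be a $p$-AUS and quasi-reflexive Banach space. Then $X$ does not coarse Lipschitz embed into $Y$. More precisely, the compression exponent $\alpha_Y(X)$ of $X$ in $Y$ satisfies the following. (i) If $X$ contains an isomorphic copy of $\ell_1$, then $\alpha_Y(X)\le\frac1p$. (ii) Otherwise, $\alpha_Y(X)\le\frac qp$.
   Context: For a map $f:X\to Y$ between Banach spaces, put $\rho_f(t)=\inf\{\|f(x)-f(y)\|:\ \|x-y\|\ge t\}$ and $\omega_f(t)=\sup\{\|f(x)-f(y)\|:\ \|x-y\|\le t\}$. The map $f$ is a coarse embedding if $\lim_{t\to\infty}\rho_f(t)=\infty$ and $\omega_f(t)<\infty$ for all $t>0$. It is a coarse Lipschitz embedding if there exist $A,B,C,D\in(0,\infty)$ such that $\omega_f(t)\le Bt+D$ and $\rho_f(t)\ge At-C$ for all $t>0$; $X$ coarse Lipschitz embeds into $Y$ if such an $f$ exists. The compression exponent $\alpha_Y(X)$ is the supremum of all $\alpha\in[0,1)$ for which there exist a coarse embedding $f:X\to Y$ and $A,C\in(0,\infty)$ with $\rho_f(t)\ge At^\alpha-C$ for all $t>0$ (with $\alpha_Y(X)=0$ if there is no such $\alpha$). A Banach space $Y$ is quasi-reflexive if the image of its canonical embedding into $Y^{**}$ has finite codimension in $Y^{**}$. For a Banach space $Y$ with unit sphere $S_Y$, $t\in[0,\infty)$, $y\in S_Y$ and $Z$ a closed linear subspace of $Y$, put $\overline{\rho}_Y(t,y,Z)=\sup_{z\in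 S_Z}(\|y+tz\|-1)$ (with value $0$ if $Z=\{0\}$), $\overline{\rho}_Y(t,y)=\inf_{\dim(Y/Z)<\infty}\overline{\rho}_Y(t,y,Z)$ and $\overline{\rho}_Y(t)=\sup_{y\in S_Y}\overline{\rho}_Y(t,y)$. $Y$ is $p$-AUS if there exists $c>0$ such that $\overline{\rho}_Y(t)\le ct^p$ for all $t\in[0,\infty)$. A Banach space $X$ has the $q$-co-Banach-Saks property ($q\in(1,\infty)$) if every semi-normalized weakly null sequence in $X$ (semi-normalized: norms bounded and bounded away from $0$) has a subsequence $(y_j)_{j=1}^\infty$ for which there is $c>0$ such that for all $k\in\mathbb N$ and all $k\le j_1<\dots<j_k$, $\|y_{j_1}+\dots+y_{j_k}\|\ge ck^{1/q}$. *)

(* Defs.v *)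
(* Everything is over the real scalar field [R : realType]; a Banach space is a
   [completeNormedModType R]. *)
From HB Require Import structures.
From mathcomp Require Import all_boot all_order all_algebra.
From mathcomp Require Import all_classical all_reals all_analysis.

Set Implicit Arguments.
Unset Strict Implicit.
Unset Printing Implicit Defensive.

Import Order.TTheory GRing.Theory Num.Theory.
Import numFieldTopology.Exports numFieldNormedType.Exports.

Local Open Scope classical_set_scope.
Local Open Scope ring_scope.

Section Dual.
Context {R : realType} (V : normedModType R).

Definition functional : {pred V -> R^o} :=
  mem [set f : V -> R^o | linear f /\ continuous f].

Lemma functionalP (f : V -> R^o) :
  reflect (linear f /\ continuous f) (f \in functional).
Proof. by apply: (iffP idP); rewrite inE. Qed.

Lemma functional_submod_closed : submod_closed functional.
Proof.
split=> [|a f g /functionalP[fl fc] /functionalP[gl gc]].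
  apply/functionalP; split; last exact: cst_continuous.
  by move=> k x y; rewrite /= scaler0 addr0.
apply/functionalP; split=> [k x y|x] /=.
  by rewrite !fctE fl gl !scalerDr !scalerA (mulrC a k) !addrA; congr (_ + _);
     rewrite -!addrA; congr (_ + _); rewrite addrC.
by apply: cvgD; [apply: cvgZl_tmp; exact: fc|exact: gc].
Qed.

HB.instance Definition _ :=
  GRing.isSubmodClosed.Build _ _ functional functional_submod_closed.

Record dual := Dual {
  dual_fun :> V -> R^o ;
  dual_funP : dual_fun \in functional }.

HB.instance Definition _ := [isSub for dual_fun].
HB.instance Definition _ := [Choice of dual by <:].
HB.instance Definition _ := [SubChoice_isSubLmodule of dual by <:].

Definition dual_norm (f : dual) : R :=
  sup [set `|f x| | x in [set x : V | `|x| <= 1]].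

Lemma dual_linear (f : dual) : linear f.
Proof. by case/functionalP: (dual_funP f). Qed.

Lemma dual_continuous (f : dual) : continuous f.
Proof. by case/functionalP: (dual_funP f). Qed.

HB.instance Definition _ (f : dual) :=
  GRing.isLinear.Build R V R^o *:%R (dual_fun f) (dual_linear f).

Lemma dualD (f g : dual) x : (f + g) x = f x + g x. Proof. by []. Qed.
Lemma dualZ (a : R) (f : dual) x : (a *: f) x = a * f x. Proof. by []. Qed.

Lemma dual_has_sup (f : dual) :
  has_sup [set `|f x| | x in [set x : V | `|x| <= 1]].
Proof.
split; first by exists `|f 0|, 0 => //=; rewrite normr0.
have /linear_boundedP := continuous_linear_bounded 0 (@dual_continuous f 0).
move=> /pinfty_ex_gt0 [r r0 fr]; exists r => _ [x /= x1 <-].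
by rewrite (le_trans (fr x))// ler_piMr// ltW.
Qed.

Lemma dual_norm_ub (f : dual) x : `|x| <= 1 -> `|f x| <= dual_norm f.
Proof.
by move=> x1; apply: ub_le_sup; [case: (dual_has_sup f)|exists x].
Qed.

Lemma dual_norm_le (f : dual) M :
  (forall x, `|x| <= 1 -> `|f x| <= M) -> dual_norm f <= M.
Proof.
move=> fM; apply: ge_sup; first by case: (dual_has_sup f).
by move=> _ [x /= x1 <-]; exact: fM.
Qed.

Lemma dual_norm_ge0 (f : dual) : 0 <= dual_norm f.
Proof. by rewrite (le_trans _ (@dual_norm_ub f 0 _))// normr0. Qed.

Lemma dual_normP (f : dual) x : `|f x| <= dual_norm f * `|x|.
Proof.
have [->|x0] := eqVneq x 0; first by rewrite linear0 !normr0 mulr0.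
rewrite -ler_pdivrMr ?normr_gt0// mulrC.
have -> : `|x|^-1 * `|f x| = `|f (`|x|^-1 *: x)|.
  by rewrite linearZ/= normrM ger0_norm ?invr_ge0.
by apply: dual_norm_ub; rewrite normrZ ger0_norm ?invr_ge0// mulVf// normr_eq0.
Qed.

Lemma dual_normD (f g : dual) : dual_norm (f + g) <= dual_norm f + dual_norm g.
Proof.
apply: dual_norm_le => x x1; rewrite dualD (le_trans (ler_normD _ _))//.
by rewrite lerD// dual_norm_ub.
Qed.

Let dual_normZ_le (a : R) (f : dual) : dual_norm (a *: f) <= `|a| * dual_norm f.
Proof.
by apply: dual_norm_le => x x1; rewrite dualZ normrM ler_wpM2l// dual_norm_ub.
Qed.

Lemma dual_normZ (a : R) (f : dual) : dual_norm (a *: f) = `|a| * dual_norm f.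
Proof.
apply/eqP; rewrite eq_le dual_normZ_le/=.
have [->|a0] := eqVneq a 0; first by rewrite normr0 mul0r dual_norm_ge0.
rewrite -ler_pdivlMl ?normr_gt0// -normfV.
by rewrite -[in leLHS](scalerK a0 f) dual_normZ_le.
Qed.

Lemma dual_norm_eq0 (f : dual) : dual_norm f = 0 -> f = 0.
Proof.
move=> f0; apply/val_inj/funext => x /=; apply/eqP.
by rewrite -normr_le0 (le_trans (dual_normP f x))// f0 mul0r.
Qed.

HB.instance Definition _ :=
  Lmodule_isNormed.Build R dual dual_normD dual_normZ dual_norm_eq0.

End Dual.

Section Bidual.
Context {R : realType} (V : normedModType R).

Definition eval_at (x : V) : dual V -> R^o := fun f => f x.

Lemma eval_at_functional x : eval_at x \in @functional R (dual V).
Proof.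
have ex_lin : linear (eval_at x) by [].
apply/functionalP; split=> //.
pose e : {linear dual V -> R^o} :=
  HB.pack (eval_at x) (GRing.isLinear.Build _ _ _ _ _ ex_lin).
apply: (@bounded_linear_continuous _ _ _ e); apply/linear_boundedP.
near=> r => f; rewrite (le_trans (dual_normP f x))// mulrC.
by rewrite ler_wpM2r ?dual_norm_ge0.
Unshelve. all: by end_near. Qed.

Definition bidual_embedding (x : V) : dual (dual V) :=
  Dual (eval_at_functional x).

End Bidual.

Section Ell1.
Context {R : realType}.

Definition summable_seq : {pred nat -> R^o} :=
  mem [set a : nat -> R^o | cvgn (series (fun n => `|a n|))].

Lemma summable_seqP (a : nat -> R^o) :
  reflect (cvgn (series (fun n => `|a n|))) (a \in summable_seq).
Proof. by apply: (iffP idP); rewrite inE. Qed.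

Lemma series_normZ (k : R) (a : nat -> R^o) :
  (fun n => `|(k *: a) n|) = `|k| *: (fun n => `|a n|).
Proof. by apply/funext => n; rewrite !fctE normrZ. Qed.

Lemma summable_seq_submod_closed : submod_closed summable_seq.
Proof.
split=> [|k a b /summable_seqP ca /summable_seqP cb]; apply/summable_seqP.
  rewrite (_ : series _ = cst 0); first exact: is_cvg_cst.
  by apply/funext => n; rewrite /series/= big1// => i _; rewrite normr0.
have ckab : cvgn (series (`|k| *: (fun n => `|a n|) + (fun n => `|b n|))).
  by apply: is_cvg_seriesD => //; exact: is_cvg_seriesZ.
apply: (series_le_cvg _ _ _ ckab) => n //=; rewrite !fctE.
  by rewrite addr_ge0// mulr_ge0.
by rewrite (le_trans (ler_normD _ _))// normrZ.
Qed.

HB.instance Definition _ :=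
  GRing.isSubmodClosed.Build _ _ summable_seq summable_seq_submod_closed.

Record ell1 := Ell1 {
  ell1_seq :> nat -> R^o ;
  ell1_seqP : ell1_seq \in summable_seq }.

HB.instance Definition _ := [isSub for ell1_seq].
HB.instance Definition _ := [Choice of ell1 by <:].
HB.instance Definition _ := [SubChoice_isSubLmodule of ell1 by <:].

Definition ell1_norm (a : ell1) : R := limn (series (fun n => `|a n|)).

Lemma ell1_cvg (a : ell1) : cvgn (series (fun n => `|a n|)).
Proof. exact/summable_seqP/ell1_seqP. Qed.

Lemma ell1_normD (a b : ell1) : ell1_norm (a + b) <= ell1_norm a + ell1_norm b.
Proof.
rewrite /ell1_norm -lim_seriesD; [|exact: ell1_cvg..].
apply: lim_series_le; first exact: (@ell1_cvg (a + b)).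
  by apply: is_cvg_seriesD; exact: ell1_cvg.
by move=> n; exact: ler_normD.
Qed.

Lemma ell1_normZ (k : R) (a : ell1) : ell1_norm (k *: a) = `|k| * ell1_norm a.
Proof.
rewrite /ell1_norm -[RHS]lim_seriesZ; last exact: ell1_cvg.
by rewrite -series_normZ.
Qed.

Lemma ell1_norm_eq0 (a : ell1) : ell1_norm a = 0 -> a = 0.
Proof.
move=> a0; apply/val_inj/funext => n /=; apply/eqP; rewrite -normr_le0 -a0.
have nd : nondecreasing_seq (series (fun n => `|a n|)).
  by apply/nondecreasing_series => ? _ _.
rewrite (le_trans _ (nondecreasing_cvgn_le nd (@ell1_cvg a) n.+1))//.
by rewrite /series/= big_nat_recr//= lerDr sumr_ge0.
Qed.

HB.instance Definition _ :=
  Lmodule_isNormed.Build R ell1 ell1_normD ell1_normZ ell1_norm_eq0.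

End Ell1.
Arguments ell1 : clear implicits.

Section BanachSpaceProperties.
Context {R : realType}.

(* dim (V / Z) < oo: finitely many classes [b i + Z] span V / Z. *)
Definition finite_codim (V : lmodType R) (Z : set V) : Prop :=
  exists (n : nat) (b : 'I_n -> V),
    forall v, exists a : 'I_n -> R, Z (v - \sum_(i < n) a i *: b i).

Definition infinite_dim (V : lmodType R) : Prop :=
  ~ exists (n : nat) (b : 'I_n -> V),
      forall v, exists a : 'I_n -> R, v = \sum_(i < n) a i *: b i.

Definition quasi_reflexive (V : normedModType R) : Prop :=
  finite_codim (range (@bidual_embedding R V)).

Definition unit_sphere (V : normedModType R) : set V := [set x | `|x| = 1].

Definition closed_subspace (V : normedModType R) (Z : set V) : Prop :=
  submod_closed [in Z] /\ closed Z.

(* The real-valued [sup] and [inf] below are those of [-1, t]-valued sets, and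
   [inf] is over a nonempty family since it contains [Z = setT].
   The library sets [sup set0 = 0], which is the required value at [Z = {0}]. *)
Definition aus_modulus_in (V : normedModType R) (t : R) (y : V) (Z : set V) : R :=
  sup [set `|y + t *: z| - 1 | z in Z `&` @unit_sphere V].

Definition aus_modulus_at (V : normedModType R) (t : R) (y : V) : R :=
  inf [set aus_modulus_in t y Z |
        Z in [set Z : set V | closed_subspace Z /\ finite_codim Z]].

Definition aus_modulus (V : normedModType R) (t : R) : R :=
  sup [set aus_modulus_at t y | y in @unit_sphere V].

Definition AUS (p : R) (V : normedModType R) : Prop :=
  exists2 c : R, 0 < c & forall t, 0 <= t -> aus_modulus V t <= c * t `^ p.

Definition weakly_null (V : normedModType R) (x : nat -> V) : Prop :=
  forall f : dual V, f (x n) @[n --> \oo] --> (0 : R^o).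

Definition semi_normalized (V : normedModType R) (x : nat -> V) : Prop :=
  exists a b : R, 0 < a /\ forall n, a <= `|x n| <= b.

Definition co_Banach_Saks (q : R) (V : normedModType R) : Prop :=
  forall x : nat -> V, semi_normalized x -> weakly_null x ->
  exists phi : nat -> nat, {homo phi : m n / (m < n)%N} /\
  exists2 c : R, 0 < c &
    forall (k : nat) (j : 'I_k -> nat),
      {homo j : i1 i2 / (i1 < i2)%N} -> (forall i, (k <= j i)%N) ->
      c * k%:R `^ q^-1 <= `|\sum_(i < k) x (phi (j i))|.

Definition contains_ell1 (V : normedModType R) : Prop :=
  exists (T : {linear ell1 R -> V}) (a b : R),
    0 < a /\ forall u, a * `|u| <= `|T u| <= b * `|u|.

End BanachSpaceProperties.

Section Embeddings.
Context {R : realType} (X Y : normedModType R).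
Local Open Scope ereal_scope.

(* Extended values: [rho f t = +oo] when no pair of points is at distance at
   least [t], and [omega f t = +oo] is possible for arbitrary [f]. *)
Definition rho (f : X -> Y) (t : R) : \bar R :=
  ereal_inf [set (`|f xy.1 - f xy.2|)%:E |
              xy in [set xy : X * X | (t <= `|xy.1 - xy.2|)%R]].

Definition omega (f : X -> Y) (t : R) : \bar R :=
  ereal_sup [set (`|f xy.1 - f xy.2|)%:E |
              xy in [set xy : X * X | (`|xy.1 - xy.2| <= t)%R]].

Definition coarse_embedding (f : X -> Y) : Prop :=
  rho f t @[t --> +oo%R] --> +oo /\ forall t : R, (0 < t)%R -> omega f t < +oo.

Definition coarse_Lipschitz_embedding (f : X -> Y) : Prop :=
  exists A B C D : R, [/\ (0 < A)%R, (0 < B)%R, (0 < C)%R, (0 < D)%R &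
    forall t : R, (0 < t)%R ->
      omega f t <= (B * t + D)%:E /\ (A * t - C)%:E <= rho f t].

Definition coarse_Lipschitz_embeds : Prop :=
  exists f : X -> Y, coarse_Lipschitz_embedding f.

Definition compression_set : set R :=
  [set alpha : R | (0 <= alpha < 1)%R /\
    exists f : X -> Y, coarse_embedding f /\
    exists A C : R, [/\ (0 < A)%R, (0 < C)%R &
      forall t : R, (0 < t)%R -> (A * t `^ alpha - C)%:E <= rho f t]].

(* [sup set0 = 0] in the library, as the definition requires. *)
Definition compression_exponent : R := sup compression_set.

End Embeddings.

(* Main.v *)
(** Let [f : X -> Y] satisfy [rho f t >= A t^alpha - C]. Iterating limits along
    a free ultrafilter [U] on [nat], "most" tuples [n1 < m1 < ... < nk < mk]
    have a meaning, and for most of them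
      [|f (x n1 + ... + x nk) - f (x m1 + ... + x mk)| <= C1 k^(1/p)]
    whenever [x] is a bounded sequence of [X]: the iterated ultralimits of the
    values of [f] live in the bidual of [Y], their differences between the
    [n]'s and the [m]'s are almost in [Y] because [Y] has finite codimension
    there, and each pair [(nj, mj)] adds to the difference an almost weakly null
    increment, whose cost is controlled by the [p]-smoothness of [Y].

    In [X] take a separated sequence [x] of the unit ball. Either for some
    [d > 0] and all [k] most alternating sums [sum_j (x nj - x mj)] have norm at
    least [d k], as for the basis of [ell1], and then [alpha <= 1/p]; or, by a
    diagonal argument, [x] has a subsequence whose successive differences are
    weakly null, to which the co-Banach-Saks property applies, and then
    [alpha <= q/p]. This dichotomy replaces Rosenthal's [ell1] theorem. *)
From HB Require Import structures.
Require Import Defs.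
From mathcomp Require Import all_boot all_order all_algebra.
From mathcomp Require Import all_classical all_reals all_analysis.
From mathcomp Require Import lra.
Import Order.TTheory GRing.Theory Num.Theory.
Import numFieldTopology.Exports numFieldNormedType.Exports.
Set Implicit Arguments.
Unset Strict Implicit.
Unset Printing Implicit Defensive.
Local Open Scope classical_set_scope.
Local Open Scope ring_scope.

(** * Hahn-Banach *)

Lemma functional_of_bound (R : realType) (V : normedModType R)
    (f : V -> R^o) (M : R) :
  linear f -> (forall x, `|f x| <= M * `|x|) -> f \in @functional R V.
Proof.
move=> fl fM; apply/functionalP; split=> //.
pose e : {linear V -> R^o} :=
  HB.pack f (GRing.isLinear.Build _ _ _ _ _ fl).
apply: (@bounded_linear_continuous _ _ _ e); apply/linear_boundedP.
near=> r => x; rewrite (le_trans (fM x))// ler_wpM2r//.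
Unshelve. all: by end_near. Qed.

Section HahnBanach.
Context {R : realType} (V : normedModType R) (y0 : V).

Let lin (G : set (V * R)) := forall x r y s (a : R),
  G (x, r) -> G (y, s) -> G (a *: x + y, a * r + s).

Let dom (G : set (V * R)) := forall x r, G (x, r) -> r <= `|x|.

(** Partial functionals are encoded by their graphs. The last clause is conditional so that the
    empty graph, which is the union of the empty chain, is good as Zorn's lemma demands. *)
Let good (G : set (V * R)) :=
  [/\ lin G, dom G & forall z, G z -> G (y0, `|y0|)].

Let good_line : good [set z | exists t : R, z = (t *: y0, t * `|y0|)].
Proof.
split.
- move=> x r y s a [t [-> ->]] [u [-> ->]]; exists (a * t + u).
  by rewrite scalerDl mulrDl scalerA mulrA.
- move=> x r [t [-> ->]].
  by rewrite normrZ ler_wpM2r// ler_norm.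
- by move=> _ _; exists 1; rewrite scale1r mul1r.
Qed.

Let good_bigcup (F : set (set (V * R))) :
  F `<=` good -> total_on F subset -> good (\bigcup_(X in F) X).
Proof.
move=> FG tot; split.
- move=> x r y s a [A FA Ax] [B FB By].
  have [AB|BA] := tot A B FA FB.
    by exists B => //; have [l _ _] := FG _ FB; apply: l => //; exact: AB.
  by exists A => //; have [l _ _] := FG _ FA; apply: l => //; exact: BA.
- by move=> x r [A FA]; have [_ d _] := FG _ FA; exact: d.
- by move=> z [A FA Az]; exists A => //; have [_ _ n] := FG _ FA; exact: n Az.
Qed.

Let good_extend (G : set (V * R)) (x : V) : good G -> G !=set0 ->
  exists c : R, good [set z | exists y r (t : R),
    G (y, r) /\ z = (y + t *: x, r + t * c)].
Proof.
move=> [Gl Gd Gn] [[y1 r1] G1].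
have G0 : G (0, 0).
  by have := Gl _ _ _ _ (-1) G1 G1; rewrite scaleN1r mulN1r !addNr.
have GD y r y' r' : G (y, r) -> G (y', r') -> G (y + y', r + r').
  by move=> a b; have := Gl _ _ _ _ 1 a b; rewrite scale1r mul1r.
have GZ a y r : G (y, r) -> G (a *: y, a * r).
  by move=> h; have := Gl _ _ _ _ a h G0; rewrite !addr0.
(* The value [c] at [x] must lie between [r - |y - x|] and [|y' + x| - r'] for all pairs of the
   graph. The supremum of the lower bounds is the least such value. *)
pose S := [set z.2 - `|z.1 - x| | z in G].
have Sub y r : G (y, r) -> ubound S (`|y + x| - r).
  move=> Gyr _ [[y' r'] /= Gy' <-].
  have := Gd _ _ (GD _ _ _ _ Gyr Gy').
  have -> : y + y' = (y + x) + (y' - x) by rewrite addrACA subrr addr0.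
  move=> /le_trans/(_ (ler_normD _ _)) h; lra.
have hS : has_sup S.
  split; first by exists (0 - `|0 - x|), (0, 0).
  by exists (`|0 + x| - 0); exact: Sub.
exists (sup S).
have c1 y r : G (y, r) -> r + sup S <= `|y + x|.
  move=> h; have : sup S <= `|y + x| - r.
    by apply: ge_sup; [case: hS|exact: Sub].
  lra.
have c2 y r : G (y, r) -> r - sup S <= `|y - x|.
  move=> h; have : r - `|y - x| <= sup S.
    by apply: ub_le_sup; [case: hS|exists (y, r)].
  lra.
split.
- move=> _ _ _ _ a [y [r [t [Gy [-> ->]]]]] [y' [r' [t' [Gy' [-> ->]]]]].
  exists (a *: y + y'), (a * r + r'), (a * t + t'); split; first exact: Gl.
  congr (_, _); first by rewrite scalerDr scalerDl scalerA addrACA.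
  lra.
- move=> _ _ [y [r [t [Gy [-> ->]]]]].
  have [t0|t0|->] := ltgtP t 0; last by rewrite scale0r mul0r !addr0; exact: Gd.
    have := c2 _ _ (GZ (- t)^-1 _ _ Gy).
    have tp : 0 < - t by rewrite oppr_gt0.
    rewrite -(ler_pM2l tp) mulrBr mulrA divff ?gt_eqF// mul1r.
    have -> : - t * `|(- t)^-1 *: y - x| = `|y + t *: x|.
      rewrite -{1}(gtr0_norm tp) -normrZ scalerBr scalerA divff ?gt_eqF//.
      by rewrite scale1r scaleNr opprK.
    by rewrite mulNr opprK.
  have := c1 _ _ (GZ t^-1 _ _ Gy).
  rewrite -(ler_pM2l t0) mulrDr mulrA divff ?gt_eqF// mul1r.
  have -> // : t * `|t^-1 *: y + x| = `|y + t *: x|.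
  by rewrite -{1}(gtr0_norm t0) -normrZ scalerDr scalerA divff ?gt_eqF// scale1r.
- by move=> _ _; exists y0, `|y0|, 0; split;
    [exact: Gn G1|rewrite scale0r mul0r !addr0].
Qed.

Lemma norming_functional :
  exists phi : dual V, `|phi| <= 1 /\ phi y0 = `|y0|.
Proof.
have [G [Gg Gmax]] := Zorn_bigcup good_bigcup.
have Gn0 : G !=set0.
  apply: contrapT => /set0P/negP/negPn/eqP G0; apply: (Gmax _ _ good_line).
  rewrite G0; split; first by [].
  by move=> /(_ (0, 0)); apply; exists 0; rewrite scale0r mul0r.
have [Gl Gd Gn] := Gg.
have Gy : G (y0, `|y0|) by case: Gn0 => z; exact: Gn.
have G0 : G (0, 0).
  by have := Gl _ _ _ _ (-1) Gy Gy; rewrite scaleN1r mulN1r !addNr.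
have tot x : exists r, G (x, r).
  apply: contrapT => nx; have [c gc] := good_extend x Gg Gn0.
  apply: Gmax gc; split.
    by move=> [y r] Gyr; exists y, r, 0; rewrite scale0r mul0r !addr0.
  move=> /(_ (x, c)) h; apply: nx; exists c; apply: h.
  by exists 0, 0, 1; rewrite scale1r mul1r !add0r.
(* [good] does not ask for single-valued graphs. Domination by the norm forces it, since the graph
   contains [(0, r' - s')]. *)
have uniq x r s : G (x, r) -> G (x, s) -> r = s.
  have le r' s' : G (x, r') -> G (x, s') -> r' <= s'.
    move=> a b; have /Gd := Gl _ _ _ _ (-1) b a.
    rewrite scaleN1r mulN1r addNr normr0; lra.
  by move=> a b; apply/eqP; rewrite eq_le !le.
have [f fG] := choice tot.
have fl : linear (f : V -> R^o).
  by move=> a x y; apply: uniq (fG _) _; exact: Gl.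
have f1 x : `|f x| <= 1 * `|x|.
  rewrite mul1r ler_norml (Gd _ _ (fG x)) andbT lerNl.
  have -> : - f x = f (- x); last by rewrite -normrN; exact: Gd (fG _).
  have := fl (-1) x 0; rewrite !scaleN1r addr0 => ->.
  have -> : f 0 = 0 by exact: uniq (fG _) G0.
  by rewrite addr0.
exists (Dual (functional_of_bound fl f1)); split.
  by apply: dual_norm_le => x x1; rewrite (le_trans (f1 x))// mul1r.
exact: uniq (fG _) Gy.
Qed.

End HahnBanach.

Lemma bidual_embedding_norm (R : realType) (V : normedModType R) (y : V) :
  `|y| <= `|bidual_embedding y|.
Proof.
have [phi [p1 py]] := norming_functional y.
rewrite -[X in X <= _]ger0_norm// -py.
exact: (@dual_norm_ub _ _ (bidual_embedding y) phi).
Qed.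

(** * Ultrafilters and ultralimits in the bidual *)

Lemma ultra_of_dichotomy (T : Type) (F : set_system T) :
  ProperFilter F -> (forall A, F A \/ F (~` A)) -> UltraFilter F.
Proof.
move=> PF FD; split=> // G PG FG; apply/seteqP; split=> // A GA.
have [//|FA] := FD A; have GC := FG _ FA.
by have [t []] := filter_ex (filterI GA GC).
Qed.

Lemma ultra_fmap (T S : Type) (F : set_system T) (f : T -> S) :
  UltraFilter F -> UltraFilter (f @ F).
Proof.
move=> UF; apply: ultra_of_dichotomy => A.
exact: (in_ultra_setVsetC (f @^-1` A) UF).
Qed.

(** The [r]-th Fubini power of [U], carried by sequences of length [r]. The head is the outermost
    quantifier, so each entry is generic with respect to the entries before it. *)
Fixpoint iter_filter (U : set_system nat) (r : nat) : set_system (seq nat) :=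
  if r is r'.+1 then
    [set P | U [set n | iter_filter U r' [set t | P (n :: t)]]]
  else [set P | P [::]].

Section IterFilter.
Context (U : set_system nat) {UU : UltraFilter U}.

#[global] Instance iter_filter_ultra r : UltraFilter (iter_filter U r).
Proof.
elim: r => [|r IH].
  apply: ultra_of_dichotomy; last by move=> A; exact: EM.
  apply: Build_ProperFilter; first by [].
  by apply: Build_Filter => // P Q PQ; exact: PQ.
have PF : ProperFilter (iter_filter U r) by exact: ultra_proper.
apply: ultra_of_dichotomy => [|A].
  apply: Build_ProperFilter => [/= h|].
    have /filter_ex[n] := h; exact: filter_not_empty.
  apply: Build_Filter => /=.
  - by apply: (@filterE _ U) => n; exact: filterT.
  - by move=> P Q; apply: (@filterS2 _ U) => n; exact: filterI.
  - by move=> P Q PQ; apply: (@filterS _ U) => n; apply: filterS => t; exact: PQ.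
have [h|h] := in_ultra_setVsetC [set n | iter_filter U r [set t | A (n :: t)]] UU.
  by left.
right; apply: filterS h => n /= nA.
by have [/nA|] := in_ultra_setVsetC [set t | A (n :: t)] IH.
Qed.

Lemma iter_filter_take i k (P : set (seq nat)) : (i <= k)%N ->
  iter_filter U i P -> iter_filter U k [set t | P (take i t)].
Proof.
elim: i k P => [|i IH] [|k] P //= ik h.
  by apply: filterE => n; apply: filterE => t.
by apply: filterS h => n; exact: IH.
Qed.

Lemma iter_filter_size r : iter_filter U r [set t | size t = r].
Proof.
elim: r => //= r IH; apply: filterE => n.
by apply: filterS IH => t /= ->.
Qed.

End IterFilter.

Section UltraLimit.
Context {R : realType} (T : Type) (G : set_system T) {UG : UltraFilter G}.

Lemma ultra_bounded_cvg (r : T -> R) (M : R) : G [set t | `|r t| <= M] ->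
  exists l : R, `|l| <= M /\ r @ G --> l.
Proof.
move=> rM; have := @segment_compact R (- M) M; rewrite compact_ultra.
have rI : G (r @^-1` [set` `[- M, M]]).
  by apply: filterS rM => t; rewrite /= in_itv/= -ler_norml.
move=> /(_ (r @ G) (ultra_fmap r UG) rI)[l [/= lM rl]].
by exists l; split=> //; move: lM; rewrite in_itv/= -ler_norml.
Qed.

Lemma cvg_near_dist (r : T -> R) (l e : R) : r @ G --> l -> 0 < e ->
  G [set t | `|r t - l| <= e].
Proof.
move=> /cvgrPdist_le rl e0; have := rl e e0.
by apply: filterS => t; rewrite distrC.
Qed.

Section Bidual.
Context {V : normedModType R}.

(** Convergence along [G] in the weak-star topology of the bidual. *)
Definition is_ulim (y : T -> V) (v : dual (dual V)) : Prop :=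
  forall phi : dual V, (phi (y t) : R) @[t --> G] --> (v phi : R).

(** The scalar ultralimits of [phi (y t)] are linear in [phi] and bounded by [M * |phi|], so
    together they form a point of the bidual. *)
Lemma ulim_exists (y : T -> V) (M : R) :
  (forall t, `|y t| <= M) -> exists v, is_ulim y v.
Proof.
move=> yM.
have M0 : 0 <= M by case: (filter_ex (@filterT _ G _)) => t _; exact: le_trans (yM t).
have bd (phi : dual V) t : `|phi (y t)| <= M * `|phi|.
  by rewrite (le_trans (dual_normP _ _))// mulrC ler_wpM2r// dual_norm_ge0.
have /choice[l lP] (phi : dual V) : exists l : R,
    `|l| <= M * `|phi| /\ (phi (y t) : R) @[t --> G] --> l.
  exact: (@ultra_bounded_cvg (fun t => phi (y t)) _ (filterE _ (bd phi))).
have ll : linear (l : dual V -> R^o).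
  move=> a f g; have [_ h] := lP (a *: f + g).
  have h' : (a * f (y t) + g (y t) : R) @[t --> G] --> (a * l f + l g : R).
    apply: cvgD; last exact: (lP g).2.
    by apply: cvgM; [exact: cvg_cst|exact: (lP f).2].
  exact: (cvg_unique _ h h').
exists (Dual (functional_of_bound ll (fun f => (lP f).1))) => phi.
exact: (lP phi).2.
Qed.

Lemma ulimB (y z : T -> V) v w : is_ulim y v -> is_ulim z w ->
  is_ulim (fun t => y t - z t) (v - w).
Proof.
move=> yv zw phi.
have h : (phi (y t) - phi (z t) : R) @[t --> G] --> (v phi - w phi : R).
  by apply: cvgB; [exact: yv|exact: zw].
by under eq_fun do rewrite linearB.
Qed.

Lemma ulimD (y z : T -> V) v w : is_ulim y v -> is_ulim z w ->
  is_ulim (fun t => y t + z t) (v + w).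
Proof.
move=> yv zw phi.
have h : (phi (y t) + phi (z t) : R) @[t --> G] --> (v phi + w phi : R).
  by apply: cvgD; [exact: yv|exact: zw].
by under eq_fun do rewrite linearD.
Qed.

Lemma ulim_cst (y : V) : is_ulim (fun=> y) (bidual_embedding y).
Proof. by move=> phi; exact: cvg_cst. Qed.

(** Weak-star lower semicontinuity of the norm. *)
Lemma ulim_norm (y : T -> V) v (M : R) : is_ulim y v ->
  G [set t | `|y t| <= M] -> `|v| <= M.
Proof.
move=> yv yM; apply: dual_norm_le => phi phi1.
apply/ler_addgt0Pr => e e0.
have [t [/= tM te]] := filter_ex (filterI yM (cvg_near_dist (yv phi) e0)).
have := dual_normP phi (y t).
have : dual_norm phi * `|y t| <= M.
  by rewrite (le_trans _ tM)// ler_piMl.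
have := ler_normB (phi (y t)) (phi (y t) - v phi).
rewrite subKr; lra.
Qed.

End Bidual.
End UltraLimit.

(* Bounded sets are totally bounded modulo a subspace of finite codimension (not
   assumed to be closed). *)
Lemma finite_codim_ultra_approx (R : realType) (T : Type) (G : set_system T)
    {UG : UltraFilter G} (V : normedModType R) (W : set V) (v : T -> V)
    (M e : R) :
  W 0 -> (forall a u u', W u -> W u' -> W (a *: u + u')) -> finite_codim W ->
  (forall t, `|v t| <= M) -> 0 < e ->
  exists w, G [set t | exists2 u, W u & `|v t - w - u| <= e].
Proof.
move=> W0 Wl [n [b Wb]] vM; elim: n => [|n IH] in W W0 Wl b Wb e *.
  move=> e0; exists 0; apply: filterE => t; exists (v t).
    by have [a] := Wb (v t); rewrite big_ord0 subr0.
  by rewrite subr0 subrr normr0 ltW.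
move=> e0.
have WZ a u : W u -> W (a *: u) by move=> /(Wl a u 0)/(_ W0); rewrite addr0.
have WD u u' : W u -> W u' -> W (u + u').
  by move=> h h'; have := Wl 1 _ _ h h'; rewrite scale1r.
pose bn := b ord_max.
(* The induction absorbs the last spanning vector into the subspace, which is why [W] and [e] are
   generalized. *)
pose W' := [set z | exists u (s : R), W u /\ z = u + s *: bn].
have [] := IH W' _ _ (b \o widen_ord (leqnSn n)) _ (e / 2).
- by exists 0, 0; rewrite scale0r addr0.
- move=> a _ _ [u [s [Wu ->]]] [u' [s' [Wu' ->]]].
  exists (a *: u + u'), (a * s + s'); split; first exact: Wl.
  by rewrite scalerDr scalerDl scalerA addrACA.
- move=> x; have [a] := Wb x; rewrite big_ord_recr/= => h.
  exists (a \o widen_ord (leqnSn n)), (x - (\sum_(i < n)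
    a (widen_ord (leqnSn n) i) *: b (widen_ord (leqnSn n) i) +
    a ord_max *: bn)), (a ord_max); split; first exact: h.
  by rewrite opprD addrA subrK.
- by rewrite divr_gt0.
move=> w Gw.
(* If [bn] stays at distance [d > 0] from [W], the coefficients of [bn] are bounded, so they
   converge along [G], and the limit multiple of [bn] is moved into the centre. Otherwise every
   multiple of [bn] is approximated by [W], and the centre [w] is kept. *)
have [[d [d0 bd]]|bW] := pselect (exists d : R, 0 < d /\
    forall u, W u -> d <= `|bn - u|); last first.
  exists w; apply: filterS Gw => t [_ [u [s [Wu ->]]] h].
  have [u' Wu' u's] : exists2 u', W u' & `|s *: bn - u'| <= e / 2.
    have [->|s0] := eqVneq s 0.
      by exists 0; rewrite // scale0r subrr normr0; lra.
    apply: contrapT => nu; apply: bW; exists (e / 2 / `|s|); split.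
      by rewrite !divr_gt0// normr_gt0.
    move=> u' Wu'; rewrite leNgt; apply/negP => h'; apply: nu.
    exists (s *: u'); first exact: WZ.
    rewrite -scalerBr normrZ mulrC -ler_pdivlMr ?normr_gt0//; exact: ltW.
  exists (u + u'); first exact: WD.
  have -> : v t - w - (u + u') = v t - w - (u + s *: bn) + (s *: bn - u').
    by rewrite !opprD !addrA subrK.
  by rewrite (le_trans (ler_normD _ _))// [e]splitr lerD.
pose P t (s : R) := exists2 u, W u & `|v t - w - (u + s *: bn)| <= e / 2.
have /choice[s sP] t : exists s : R, (exists s, P t s) -> P t s.
  by have [[s]|] := pselect (exists s, P t s); [exists s|exists 0].
have Gs : G [set t | P t (s t)].
  by apply: filterS Gw => t [_ [u [s' [Wu ->]]] h]; apply: sP; exists s', u.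
have Gb : G [set t | `|s t| <= (M + `|w| + e / 2) / d].
  apply: filterS Gs => t [u Wu h] /=.
  have [->|s0] := eqVneq (s t) 0.
    have M0 : 0 <= M by exact: le_trans (vM t).
    by rewrite normr0 divr_ge0 ?(ltW d0)// !addr_ge0 ?divr_ge0 ?(ltW e0).
  rewrite ler_pdivlMr// mulrC.
  have : d <= `|bn - - (s t)^-1 *: u| by apply: bd; exact: WZ.
  rewrite -(ler_pM2l (_ : 0 < `|s t|)) ?normr_gt0// [_ * d]mulrC => h1.
  apply: (le_trans h1).
  rewrite -normrZ scalerBr scalerA mulrN divff// scaleN1r opprK addrC.
  have -> : u + s t *: bn = (v t - w) - (v t - w - (u + s t *: bn)).
    by rewrite subKr.
  rewrite (le_trans (ler_normB _ _))// lerD//.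
  by rewrite (le_trans (ler_normB _ _))// lerD.
have [s0 [_ ss0]] := ultra_bounded_cvg Gb.
have e'0 : 0 < e / 2 / (`|bn| + 1) by rewrite !divr_gt0// ltr_wpDl.
exists (w + s0 *: bn).
have Gd := cvg_near_dist (UG := UG) ss0 e'0.
apply: filterS (filterI Gs Gd) => t [[u Wu h] /= h']; exists u => //.
have -> : v t - (w + s0 *: bn) - u =
    v t - w - (u + s t *: bn) + (s t - s0) *: bn.
  by rewrite scalerBl !opprD !addrA subrK; exact: addrAC.
rewrite (le_trans (ler_normD _ _))// [e]splitr lerD// normrZ.
apply: (le_trans (ler_wpM2r (normr_ge0 bn) h')).
rewrite mulrAC ler_pdivrMr ?ltr_wpDl// ler_wpM2l//; first by rewrite divr_ge0// ltW.
by rewrite lerDl.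
Qed.

(** * Asymptotic smoothness *)

Section AsymptoticSmoothness.
Context {R : realType} (Y : normedModType R).

Let modulus_ub (t : R) (y : Y) (Z : set Y) : 0 <= t -> unit_sphere y ->
  ubound [set `|y + t *: z| - 1 | z in Z `&` @unit_sphere R Y] t.
Proof.
move=> t0 y1 _ [z [_ z1] <-].
rewrite lerBlDr (le_trans (ler_normD _ _))// normrZ ger0_norm//.
by rewrite z1 mulr1 addrC y1.
Qed.

Let modulus_in_ge (t : R) (y : Y) (Z : set Y) : 0 <= t -> unit_sphere y ->
  - 1 <= aus_modulus_in t y Z.
Proof.
move=> t0 y1; rewrite /aus_modulus_in.
have [-> |/set0P[r Sr]] :=
  eqVneq [set `|y + t *: z| - 1 | z in Z `&` @unit_sphere R Y] set0.
  by rewrite sup0; lra.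
apply: (@le_trans _ _ r).
  by case: Sr => z _ <-; rewrite lerBrDr addNr.
by apply: ub_le_sup => //; exists t; exact: modulus_ub.
Qed.

Let finite_codimT : closed_subspace [set: Y] /\ finite_codim [set: Y].
Proof.
split; last by exists 0, (fun=> 0) => v; exists (fun=> 0).
by split; [split; [rewrite inE|move=> ? ? ? _ _; rewrite inE]|exact: closedT].
Qed.

Lemma aus_modulus_approx (t d : R) (y : Y) :
  0 <= t -> 0 < d -> unit_sphere y ->
  exists Z : set Y, [/\ closed_subspace Z, finite_codim Z &
    forall z, Z z -> unit_sphere z -> `|y + t *: z| <= 1 + aus_modulus Y t + d].
Proof.
move=> t0 d0 y1.
(* Real [sup] and [inf] are meaningful only for nonempty bounded sets, so the bounds [-1] and [t]
   are checked at each level of the modulus. *)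
have atI (y' : Y) : unit_sphere y' ->
    has_inf [set aus_modulus_in t y' Z |
        Z in [set Z : set Y | closed_subspace Z /\ finite_codim Z]].
  move=> y'1; split; first by exists (aus_modulus_in t y' setT), setT.
  by exists (- 1) => _ [Z _ <-]; exact: modulus_in_ge.
have atT (y' : Y) : unit_sphere y' -> aus_modulus_at t y' <= t.
  move=> y'1; apply: (@le_trans _ _ (aus_modulus_in t y' setT)).
    by apply: ge_inf; [case: (atI _ y'1)|exists setT].
  rewrite /aus_modulus_in; have := modulus_ub (Z := setT) t0 y'1.
  move: (image _ _) => S Sub.
  by have [->|/set0P S0] := eqVneq S set0; [rewrite sup0|exact: ge_sup].
have [_ [Z [Zc Zf] <-]] := inf_adherent d0 (atI _ y1).
have h1 : aus_modulus_at t y <= aus_modulus Y t.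
  apply: ub_le_sup; last by exists y.
  by exists t => _ [y' y'1 <-]; exact: atT.
move=> h2; exists Z; split=> // z Zz z1.
have h3 : `|y + t *: z| - 1 <= aus_modulus_in t y Z.
  apply: ub_le_sup; last by exists z.
  by exists t; exact: modulus_ub.
move: h1 h2 h3; rewrite /aus_modulus_at; lra.
Qed.

(** Convexity: [x + s *: z] is the mean of [x + z] and [x - z] with weights [(1 + s) / 2] and
    [(1 - s) / 2]. *)
Let norm_between (x z : Y) (s B : R) : `|s| <= 1 ->
  `|x + z| <= B -> `|x - z| <= B -> `|x + s *: z| <= B.
Proof.
move=> s1 h1 h2; have /andP[s2 s3] : -1 <= s <= 1 by rewrite -ler_norml.
have -> : x + s *: z = ((1 + s) / 2) *: (x + z) + ((1 - s) / 2) *: (x - z).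
  rewrite !scalerDr addrACA scalerN -scalerBl -scalerDl.
  have -> : (1 + s) / 2 + (1 - s) / 2 = 1 by lra.
  have -> : (1 + s) / 2 - (1 - s) / 2 = s by lra.
  by rewrite scale1r.
rewrite (le_trans (ler_normD _ _))// !normrZ.
rewrite !ger0_norm ?divr_ge0//; try lra.
have : (1 + s) / 2 * `|x + z| <= (1 + s) / 2 * B by rewrite ler_wpM2l//; lra.
have : (1 - s) / 2 * `|x - z| <= (1 - s) / 2 * B by rewrite ler_wpM2l//; lra.
lra.
Qed.

(** The modulus treats vectors of norms exactly [S] and [K]; convexity and the symmetry of [Z]
    extend the bound to smaller norms. With [S] of order [K * k^(1/p)] and [d] of order [1/k], one
    step costs a factor [1 + O(1/k)], so [k] steps cost a bounded factor. *)
Lemma AUS_step (p c K S d : R) (y : Y) :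
  (forall t, 0 <= t -> aus_modulus Y t <= c * t `^ p) ->
  0 < K -> K <= S -> 0 < d -> 0 <= c -> `|y| <= S ->
  exists Z : set Y, [/\ closed_subspace Z, finite_codim Z &
    forall z, Z z -> `|z| <= K -> `|y + z| <= S * (1 + c * (K / S) `^ p + d)].
Proof.
move=> ac K0 KS d0 c0 yS; have S0 : 0 < S by exact: lt_le_trans KS.
have [->|yn0] := eqVneq y 0.
  have [Zc Zf] := finite_codimT; exists setT; split=> // z _ zK.
  rewrite add0r (le_trans zK)// (le_trans KS)// ler_peMr ?(ltW S0)//.
  have : 0 <= c * (K / S) `^ p by rewrite mulr_ge0// powR_ge0.
  lra.
have ny0 : 0 < `|y| by rewrite normr_gt0.
pose y1 := `|y|^-1 *: y.
have y11 : unit_sphere y1.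
  by rewrite /unit_sphere/= normrZ normfV normr_id mulVf ?gt_eqF.
have KS0 : 0 <= K / S by rewrite divr_ge0// ltW.
have [Z [Zc Zf Zm]] := aus_modulus_approx KS0 d0 y11.
exists Z; split=> // z Zz zK.
set B := S * _.
have [[Z0 Zl] _] := Zc.
have ZZ a x : Z x -> Z (a *: x).
  by have := Zl a x 0; rewrite !inE addr0 => h Zx; apply: h => //; move: Z0; rewrite inE.
have m z' : Z z' -> unit_sphere z' -> `|S *: y1 + K *: z'| <= B.
  move=> h1 h2; have -> : S *: y1 + K *: z' = S *: (y1 + (K / S) *: z').
    by rewrite scalerDr scalerA [S * (K / S)]mulrC divfK ?gt_eqF.
  rewrite normrZ gtr0_norm// ler_wpM2l ?(ltW S0)// (le_trans (Zm z' h1 h2))//.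
  by rewrite lerD2r lerD2l ac.
(* First shrink the norm of [z'] below [K]; afterwards the roles are exchanged to shrink that of [y]
   below [S]. *)
have mz z' : Z z' -> `|z'| <= K -> `|S *: y1 + z'| <= B.
  have [->|z0] := eqVneq z' 0 => Zz' z'K.
    rewrite addr0 normrZ y11 mulr1 gtr0_norm// ler_peMr ?(ltW S0)//.
    have : 0 <= c * (K / S) `^ p by rewrite mulr_ge0// powR_ge0.
    lra.
  have nz0 : 0 < `|z'| by rewrite normr_gt0.
  have -> : z' = (`|z'| / K) *: (K *: (`|z'|^-1 *: z')).
    by rewrite !scalerA divfK ?gt_eqF// divff ?gt_eqF// scale1r.
  have u1 : unit_sphere (`|z'|^-1 *: z').
    by rewrite /unit_sphere/= normrZ normfV normr_id mulVf ?gt_eqF.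
  apply: norm_between.
  - by rewrite ger0_norm ?divr_ge0 ?(ltW K0)// ler_pdivrMr// mul1r.
  - by apply: m => //; exact: ZZ.
  - rewrite -scalerN; apply: m; first by rewrite -scaleNr; exact: ZZ.
    by rewrite /unit_sphere/= normrN.
have -> : y + z = z + (`|y| / S) *: (S *: y1).
  by rewrite !scalerA divfK ?gt_eqF// divff ?gt_eqF// scale1r addrC.
apply: norm_between; first by rewrite ger0_norm ?divr_ge0 ?(ltW S0)// ler_pdivrMr// mul1r.
  by rewrite addrC; exact: mz.
rewrite -normrN opprB; apply: mz; last by rewrite normrN.
by rewrite -scaleN1r; exact: ZZ.
Qed.

End AsymptoticSmoothness.

(** * Upper bound for interlaced tuples *)

(** One sequence [n1, m1, n2, m2, ...] encodes two interlaced tuples: [evens] extracts the [n]'s and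
    [odds] the [m]'s. An unpaired last entry is dropped. *)
Fixpoint evens (T : Type) (s : seq T) : seq T :=
  if s is a :: _ :: t then a :: evens t else [::].

Fixpoint odds (T : Type) (s : seq T) : seq T :=
  if s is _ :: b :: t then b :: odds t else [::].

Section InterlacedUpperBound.
Context {R : realType} (Y : normedModType R) (U : set_system nat)
  {UU : UltraFilter U}.
Variables (p c : R).
Hypotheses (c0 : 0 <= c)
  (Yc : forall t, 0 <= t -> aus_modulus Y t <= c * t `^ p).

Let bidualB (y z : Y) :
  bidual_embedding (y - z) = bidual_embedding y - bidual_embedding z.
Proof. by apply/val_inj/funext => phi; exact: linearB. Qed.

(** A dummy first coordinate lets functions of [r] and of [r.+1] entries be subtracted along one
    filter. *)
Lemma ulim_behead r (A : seq nat -> Y) n v :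
  is_ulim (iter_filter U r) (fun t => A (n :: t)) v ->
  is_ulim (iter_filter U r.+1) (fun s => A (n :: behead s)) v.
Proof.
move=> h phi P /h hP /=.
by apply: (@filterE _ U) => n'; exact: hP.
Qed.

(** Fixing one more entry on each side adds [(a_ n - a) - (b_ m - b)] to [a - b]. The difference
    [a - b] is close to [y] in [Y], and the increment is an ultralimit of vectors close to the
    subspace [Z] that smoothness attaches to [y]; [AUS_step] bounds their sums with [y], and the
    bound passes to the limit. *)
Lemma interlaced_step r (A B : seq nat -> Y) (a b : dual (dual Y))
    (a_ b_ : nat -> dual (dual Y)) (M L N e d e' : R) (y : Y) :
  0 < L -> 0 < d -> 0 < e' -> 4 * e' <= L -> 0 <= e -> 3 * L <= N ->
  (forall s, `|A s| <= M) -> (forall s, `|B s| <= M) ->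
  (forall n n' t, `|A (n :: t) - A (n' :: t)| <= L) ->
  (forall n n' t, `|B (n :: t) - B (n' :: t)| <= L) ->
  is_ulim (iter_filter U r.+1) A a -> is_ulim (iter_filter U r.+1) B b ->
  (forall n, is_ulim (iter_filter U r) (fun t => A (n :: t)) (a_ n)) ->
  (forall n, is_ulim (iter_filter U r) (fun t => B (n :: t)) (b_ n)) ->
  `|a - b| <= N -> `|a - b - bidual_embedding y| <= e ->
  U [set n | U [set m | `|a_ n - b_ m| <=
    (N + e) * (1 + c * (3 * L / (N + e)) `^ p + d) + 4 * e' + e]].
Proof.
move=> L0 d0 e'0 e'L e0 LN AM BM AL BL Aa Ba Aa_ Ba_ abN abe.
have yN : `|y| <= N + e.
  rewrite (le_trans (bidual_embedding_norm y))//.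
  rewrite -[X in `|X|](subKr (a - b)) (le_trans (ler_normB _ _))//.
  exact: lerD.
have K0 : 0 < 3 * L by rewrite mulr_gt0.
have KN : 3 * L <= N + e by rewrite (le_trans LN)// lerDl.
have [Z [[[Z0 Zl] _] Zf Zy]] := AUS_step Yc K0 KN d0 c0 yN.
have ZB x z : Z x -> Z z -> Z (x - z).
  by have := Zl (-1) z x; rewrite !inE scaleN1r addrC => h *; apply: h.
have Z0' : Z 0 by move: Z0; rewrite inE.
have Zl' (s : R) u u' : Z u -> Z u' -> Z (s *: u + u').
  by have := Zl s u u'; rewrite !inE => h *; apply: h.
(* Modulo [Z], most values of [A] are close to one point [wA]. The filter being iterated, for most
   [n] the same holds for most values [A (n :: t)], so the difference of two such values is close to
   [Z]. *)
have [wA GA] :=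
  finite_codim_ultra_approx (G := iter_filter U r.+1) Z0' Zl' Zf AM e'0.
have [wB GB] :=
  finite_codim_ultra_approx (G := iter_filter U r.+1) Z0' Zl' Zf BM e'0.
have /= := GA; apply: filterS => n GAn; have /= := GB; apply: filterS => m GBm /=.
(* The increment before passing to the limit, with the same tail in all four terms. *)
pose h s := A (n :: behead s) - A s - (B (m :: behead s) - B s).
have hv : is_ulim (iter_filter U r.+1) h (a_ n - a - (b_ m - b)).
  by apply: ulimB; apply: ulimB => //; exact: ulim_behead.
have -> : a_ n - b_ m = (a - b - bidual_embedding y) +
    (a_ n - a - (b_ m - b) + bidual_embedding y).
  have -> : a_ n - a - (b_ m - b) = a_ n - b_ m - (a - b).
    by rewrite !opprB addrACA [RHS]addrACA [- a - _]addrC.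
  by rewrite [RHS]addrC addrACA subrK subrr addr0.
rewrite (le_trans (ler_normD _ _))// addrC lerD//.
have hy : is_ulim (iter_filter U r.+1) (fun=> y) (bidual_embedding y).
  exact: ulim_cst.
apply: (ulim_norm (ulimD hv hy)).
have GAr : iter_filter U r.+1
    [set s | exists2 u, Z u & `|A (n :: behead s) - wA - u| <= e'].
  by apply: (@filterE _ U) => n'.
have GBr : iter_filter U r.+1
    [set s | exists2 u, Z u & `|B (m :: behead s) - wB - u| <= e'].
  by apply: (@filterE _ U) => n'.
have Gsz := @iter_filter_size U UU r.+1.
apply: filterS (filterI (filterI (filterI GA GAr) (filterI GB GBr)) Gsz).
move=> [|n' s] [[[[u1 Z1 h1] [u2 Z2 h2]] [[u3 Z3 h3] [u4 Z4 h4]]] // _].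
rewrite /h; move: h2 h4 => /= h2 h4.
(* Four approximations put [hs] within [4 * e'] of [z] in [Z]. Two changes of one entry give
   [|hs| <= 2 * L], hence [|z| <= 3 * L], the value of [K] given to [AUS_step]. *)
set hs := (X in X + y); pose z := u2 - u1 - (u4 - u3).
have zZ : Z z by apply: (ZB); apply: (ZB).
have hL : `|hs| <= 2 * L.
  by rewrite mulr_natl (le_trans (ler_normB _ _))// lerD.
have hz : `|hs - z| <= 4 * e'.
  have -> : hs - z = (A (n :: s) - wA - u2) - (A (n' :: s) - wA - u1) -
      ((B (m :: s) - wB - u4) - (B (n' :: s) - wB - u3)).
    have E2 (x x' u u' : Y) : x - x' - (u - u') = x - u - (x' - u').
      by rewrite !opprB addrACA [RHS]addrACA [- x' - _]addrC.
    have E (x x' w u u' : Y) : x - w - u - (x' - w - u') = x - x' - (u - u').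
      by rewrite [x - _ - _]addrAC [x' - _ - _]addrAC opprB subrKA E2.
    by rewrite !E /z /hs E2.
  have -> : 4 * e' = e' + e' + (e' + e') by lra.
  by rewrite (le_trans (ler_normB _ _))// lerD// (le_trans (ler_normB _ _))// lerD.
have -> : hs + y = y + z + (hs - z) by rewrite addrC -addrA [z + _]addrC subrK.
rewrite (le_trans (ler_normD _ _))// lerD// Zy//.
rewrite -[z](subKr hs) (le_trans (ler_normB _ _))//; lra.
Qed.

(** With [i = 1/k], the errors beyond [N * (1 + (c + 1) * i)] add up to at most
    [e * (c + 3) + L * i = 3/2 * L * i], hence to at most [N * i / 2]. *)
Let step_bound (N L x i e : R) : 0 < i <= 1 -> 0 < L -> 3 * L <= N ->
  x <= i -> 0 <= e -> e * (c + 3) = L * i / 2 ->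
  (N + e) * (1 + c * x + i) + L * i + e <= N * (1 + (c + 2) * i).
Proof.
move=> /andP[i0 i1] L0 LN xi e0 ec.
have h1 : (N + e) * (1 + c * x + i) <= (N + e) * (1 + c * i + i).
  by rewrite ler_wpM2l ?addr_ge0// ?lerD// ?ler_wpM2l//; lra.
have h2 : e * ((c + 1) * i) <= e * (c + 1).
  by rewrite ler_wpM2l// ler_piMr// addr_ge0.
have h3 : 3 * L * i <= N * i by rewrite ler_wpM2r// ltW.
have : 0 < L * i by rewrite mulr_gt0.
by move: h1 h2 h3 ec; nra.
Qed.

(* The ultralimits [g s] of [f] beyond the prefix [s] lie in the bidual, and the
   defect of reflexivity being finite dimensional, [g s - w (size s)] is almost
   in [Y] for most [s]. Hence so is [g s - g s'], to which the smoothness of [Y]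
   applies; it is updated by one coordinate of [s] and one of [s'] at a time. *)
Lemma interlaced_upper (k : nat) (f : seq nat -> Y) (M L : R) :
  (0 < k)%N -> 0 < L -> 0 < p -> quasi_reflexive Y ->
  (forall s, `|f s| <= M) ->
  (forall s n n' t, `|f (s ++ n :: t) - f (s ++ n' :: t)| <= L) ->
  iter_filter U k.*2 [set t | `|f (evens t) - f (odds t)| <=
    3 * L * expR (c + 2) * k%:R `^ p^-1].
Proof.
move=> k0 L0 p0 QR fM fL.
have /choice[g gP] (s : seq nat) : exists v : dual (dual Y),
    is_ulim (iter_filter U (k - size s)) (fun t => f (s ++ t)) v.
  by apply: (@ulim_exists _ _ _ _ _ _ M).
have gM s : `|g s| <= M.
  by apply: (ulim_norm (gP s)); apply: filterE => t; exact: fM.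
pose i : R := k%:R^-1.
have kR : 0 < (k%:R : R) by rewrite ltr0n.
have i01 : 0 < i <= 1 by rewrite invr_gt0 kR/= invf_le1// ler1n.
have [i0 i1] := andP i01.
pose e := L * i / 2 / (c + 3).
have e0 : 0 < e by rewrite !divr_gt0 ?mulr_gt0// ltr_wpDl.
have ec : e * (c + 3) = L * i / 2 by rewrite divfK// gt_eqF// ltr_wpDl.
have e20 : 0 < e / 2 by rewrite divr_gt0.
have /choice[w wP] j : exists w,
    iter_filter U j [set s | exists2 u, range (@bidual_embedding R Y) u &
      `|g s - w - u| <= e / 2].
  apply: finite_codim_ultra_approx QR gM e20.
    by exists 0 => //; apply/val_inj/funext => phi; exact: linear0.
  move=> a _ _ [y _ <-] [y' _ <-]; exists (a *: y + y') => //.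
  by apply/val_inj/funext => phi; exact: linearP.
(* A [k]-tuple in [Q] has all its prefixes good at once, so the sections of [Q] serve every stage of
   the induction. *)
pose Q s := forall j : 'I_k.+1,
  exists2 u, range (@bidual_embedding R Y) u & `|g (take j s) - w j - u| <= e / 2.
have QP : iter_filter U k Q.
  apply: filter_forall => j.
  by apply: iter_filter_take (wP j); rewrite -ltnS.
(* [T j] bounds the difference once [j] pairs are fixed. The value of [T0] makes [(3 * L / T0)^p]
   equal to [1/k], so each pair costs a factor [1 + (c + 2) / k], and all [k] of them at most
   [expR (c + 2)]. *)
pose T0 := 3 * L * k%:R `^ p^-1.
pose T j := T0 * (1 + (c + 2) * i) ^+ j.
have k1 : 1 <= k%:R `^ p^-1 :> R.
  by rewrite -[leLHS](powRr0 k%:R) ler_powR ?ler1n// invr_ge0 ltW.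
have T0L : 3 * L <= T0 by rewrite ler_peMr// mulr_ge0// ltW.
have TT0 j : T0 <= T j.
  rewrite ler_peMr ?(le_trans _ T0L) ?mulr_ge0 ?(ltW L0)//.
  by rewrite exprn_ege1// lerDl mulr_ge0 ?addr_ge0// ltW.
have Tk : T k <= 3 * L * expR (c + 2) * k%:R `^ p^-1.
  rewrite /T /T0 [leRHS]mulrAC ler_wpM2l ?(le_trans _ T0L) ?mulr_ge0 ?(ltW L0)//.
  have cE : c + 2 = k%:R * ((c + 2) * i).
    by rewrite mulrCA divff ?mulr1// gt_eqF.
  rewrite [in leRHS]cE expRM_natl; apply: lerXn2r; rewrite ?nnegrE ?expR_ge0//.
    by rewrite addr_ge0 ?mulr_ge0 ?addr_ge0// ltW.
  exact: expR_ge1Dx.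
(* Induction on the number [r] of entries still to be chosen on each side, the prefixes [s] and [s']
   being already fixed. *)
have main r s s' : (size s + r)%N = k -> (size s' + r)%N = k ->
    `|g s - g s'| <= T (size s) ->
    iter_filter U r [set t | Q (s ++ t)] ->
    iter_filter U r [set t | Q (s' ++ t)] ->
    iter_filter U r.*2 [set t | `|f (s ++ evens t) - f (s' ++ odds t)| <= T k].
  elim: r s s' => [|r IH] s s' sr s'r ss' Qs Qs'.
    (* With no entry left the filter is principal at the empty sequence, so [g s - g s'] is the
       image of [f s - f s'] in the bidual. *)
    have Fz : iter_filter U 0 [set t | `|f (s ++ t) - f (s' ++ t) -
        (f s - f s')| <= 0] by rewrite /= !cats0 subrr normr0.
    rewrite /= !cats0 (le_trans (bidual_embedding_norm _))//.
    have hs : (k - size s = 0)%N by rewrite -sr addKn.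
    have hs' : (k - size s' = 0)%N by rewrite -s'r addKn.
    have := gP s; have := gP s'; rewrite hs hs' => g's gs.
    have hc : is_ulim (iter_filter U 0) (fun=> f s - f s')
        (bidual_embedding (f s - f s')) by exact: ulim_cst.
    have : `|g s - g s' - bidual_embedding (f s - f s')| <= 0.
      exact: (ulim_norm (ulimB (ulimB gs g's) hc) Fz).
    rewrite normr_le0 subr_eq0 => /eqP <-.
    by rewrite -sr addn0.
  have near_g s0 : (size s0 + r.+1)%N = k ->
      iter_filter U r.+1 [set t | Q (s0 ++ t)] ->
      exists y, `|g s0 - w (size s0) - bidual_embedding y| <= e / 2.
    move=> s0r /filter_ex[t Qt].
    have s0k : (size s0 < k.+1)%N by rewrite ltnS -s0r leq_addr.
    have [_ [y _ <-]] := Qt (Ordinal s0k).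
    by rewrite /= take_size_cat// => h; exists y.
  have [y1 y1P] := near_g s sr Qs; have [y2 y2P] := near_g s' s'r Qs'.
  (* The prefixes have equal lengths, so the same centre [w (size s)] cancels in the difference. *)
  have ss : size s = size s' by apply/eqP; rewrite -(eqn_add2r r.+1) sr s'r.
  have ye : `|g s - g s' - bidual_embedding (y1 - y2)| <= e.
    rewrite bidualB.
    have -> : g s - g s' - (bidual_embedding y1 - bidual_embedding y2) =
        g s - w (size s) - bidual_embedding y1 -
        (g s' - w (size s') - bidual_embedding y2).
      rewrite ss [g s - w _ - _]addrAC [g s' - w _ - _]addrAC.
      rewrite [- (g s' - _ - w _)]opprB subrKA !opprB.
      by rewrite addrACA [RHS]addrACA [- g s' - _]addrC.
    by rewrite (le_trans (ler_normB _ _))// [e]splitr lerD.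
  have i40 : 0 < L * i / 4 by rewrite divr_gt0// mulr_gt0.
  have TS : T (size s).+1 = T (size s) * (1 + (c + 2) * i).
    by rewrite /T exprSr mulrA.
  have i4E : 4 * (L * i / 4) = L * i by lra.
  have i4L : 4 * (L * i / 4) <= L by rewrite mulrC divfK// ler_piMr// ltW.
  have ksE s0 : (size s0 + r.+1)%N = k -> (k - size s0 = r.+1)%N.
    by move=> <-; rewrite addKn.
  have ksE' s0 n : (size s0 + r.+1)%N = k -> (k - size (rcons s0 n) = r)%N.
    by rewrite size_rcons => <-; rewrite -addSnnS addKn.
  have LT : 3 * L <= T (size s) by rewrite (le_trans T0L).
  have gs := gP s; rewrite ksE// in gs.
  have gs' := gP s'; rewrite ksE// in gs'.
  have gr s0 : (size s0 + r.+1)%N = k -> forall n,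
      is_ulim (iter_filter U r) (fun t => f (s0 ++ n :: t)) (g (rcons s0 n)).
    move=> s0r n; have := gP (rcons s0 n); rewrite ksE'//.
    by under eq_fun do rewrite cat_rcons.
  have := interlaced_step (A := fun t => f (s ++ t)) (B := fun t => f (s' ++ t))
    L0 i0 i40 i4L (ltW e0) LT (fun t => fM _) (fun t => fM _)
    (fun n n' t => fL s n n' t) (fun n n' t => fL s' n n' t) gs gs'
    (gr s sr) (gr s' s'r) ss' ye.
  move: Qs; rewrite /= => Qs; move: Qs'; rewrite /= => Qs' St.
  apply: filterS (filterI Qs St) => n [Qn Sn].
  apply: filterS (filterI Qs' Sn) => m [Qm Sm].
  have IHn : `|g (rcons s n) - g (rcons s' m)| <= T (size (rcons s n)).
    rewrite size_rcons; apply: (le_trans Sm); rewrite TS i4E.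
    apply: step_bound => //; last exact: ltW.
    have -> : i = (3 * L / T0) `^ p.
      rewrite /T0 invfM mulrA divff ?gt_eqF ?mulr_gt0// mul1r.
      by rewrite -powRN -powRrM mulNr mulVf ?gt_eqF// powR_inv1// ltW.
    have T00 : 0 < T0 by rewrite (lt_le_trans _ T0L)// mulr_gt0.
    rewrite ge0_ler_powR ?nnegrE ?(ltW p0)//.
    + by rewrite divr_ge0 ?mulr_ge0 ?addr_ge0 ?(ltW L0) ?(ltW e0)// (le_trans (ltW T00)).
    + by rewrite divr_ge0 ?mulr_ge0 ?(ltW L0)// ltW.
    + rewrite ler_pM2l ?mulr_gt0// lef_pV2 ?posrE//.
        by rewrite (le_trans (TT0 (size s)))// lerDl ltW.
      by rewrite ltr_wpDr ?(ltW e0)// (lt_le_trans T00).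
  have := IH (rcons s n) (rcons s' m).
  rewrite !size_rcons !addSn -!addnS -(size_rcons s n) => /(_ sr s'r IHn).
  have Qrc s0 n0 : iter_filter U r [set t | Q (s0 ++ n0 :: t)] ->
      iter_filter U r [set t | Q (rcons s0 n0 ++ t)].
    by apply: filterS => t /=; rewrite cat_rcons.
  move=> /(_ (Qrc _ _ Qn) (Qrc _ _ Qm)).
  by apply: filterS => t /=; rewrite !cat_rcons.
have := main k [::] [::] erefl erefl; rewrite subrr normr0.
have T00 : 0 <= T 0%N by rewrite (le_trans _ (TT0 0%N))// (le_trans _ T0L)// mulr_ge0// ltW.
move=> /(_ T00 QP QP).
by apply: filterS => t /= /le_trans; apply.
Qed.

End InterlacedUpperBound.

(** * Diagonal subsequences *)

Lemma iter_filter_notin (U : set_system nat) {UU : UltraFilter U} r n :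
  (forall m, U [set n | (m < n)%N]) -> iter_filter U r [set t | n \notin t].
Proof.
move=> Uoo; elim: r => //= r IH; apply: filterS (Uoo n) => m /= nm.
by apply: filterS IH => t /= nt; rewrite inE negb_or nt andbT ltn_eqF.
Qed.

Lemma iter_filter_uniq (U : set_system nat) {UU : UltraFilter U} r :
  (forall m, U [set n | (m < n)%N]) -> iter_filter U r [set t | uniq t].
Proof.
move=> Uoo; elim: r => //= r IH; apply: filterE => n.
apply: filterS (filterI IH (iter_filter_notin r n Uoo)).
by move=> t [/= -> ->].
Qed.

Lemma subseq_rcons_cases (T : eqType) (s t : seq T) (n : T) :
  subseq t (rcons s n) ->
  subseq t s \/ exists2 t', subseq t' s & t = rcons t' n.
Proof.
elim/last_ind: t => [|t x _]; first by left; exact: sub0seq.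
rewrite -subseq_rev !rev_rcons /=; case: eqP => [->|_] h.
  by right; exists t; rewrite // -subseq_rev.
by left; rewrite -subseq_rev rev_rcons.
Qed.

(* Plays the role of the infinite Ramsey theorem for all the sizes [d i] at
   once. *)
Lemma diagonal_subsequence (U : set_system nat) {UU : UltraFilter U}
    (d : nat -> nat) (P : nat -> set (seq nat)) :
  (forall m, U [set n | (m < n)%N]) ->
  (forall i, iter_filter U (d i) (P i)) ->
  exists a : nat -> nat, {homo a : m n / (m < n)%N} /\
    forall i l, sorted ltn l -> size l = d i -> all (leq i) l ->
      P i (map a l).
Proof.
move=> Uoo UP.
(* A prefix is good when any subsequence of its entries from position [i] on extends, by most
   tuples, to a member of [P i]. Starting at position [i] leaves only finitely many conditions on
   each new entry. *)
pose good s := forall i t, subseq t (drop i s) -> (size t <= d i)%N ->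
  iter_filter U (d i - size t) [set u | P i (t ++ u)].
have good0 : good [::].
  by move=> i t; rewrite /= => /eqP -> _; rewrite subn0; exact: UP.
have good_next s : good s -> U [set n | good (rcons s n)].
  move=> gs.
  pose C i t n := (size t < d i)%N ->
    iter_filter U (d i - (size t).+1) [set u | P i (t ++ n :: u)].
  have C1 i t : subseq t (drop i s) -> U [set n | C i t n].
    move=> ts; rewrite /C.
    have [lt|le] := ltnP (size t) (d i); last by apply: (@filterE _ U).
    have := gs i t ts (ltnW lt).
    by rewrite -subSS subSn//=; apply: (@filterS _ U) => n h _.
  (* Subsequences are indexed by boolean masks, a finite type, so finitely many large sets are
     intersected. *)
  have C2 i : U [set n | forall m : (size (drop i s)).-tuple bool,
      C i (mask m (drop i s)) n].
    by apply: filter_forall => m; apply: C1; exact: mask_subseq.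
  have : U [set n | forall (i : 'I_(size s).+1)
      (m : (size (drop i s)).-tuple bool), C i (mask m (drop i s)) n].
    by apply: filter_forall => i; exact: C2.
  apply: filterS => n h i t.
  have [si|si] := ltnP (size s) i.
    by rewrite drop_oversize ?size_rcons//= => /eqP -> _; rewrite subn0; exact: UP.
  rewrite drop_rcons// => /subseq_rcons_cases[ts|[t' /subseqP[m sm ->] ->]].
    exact: gs.
  have is1 : (i < (size s).+1)%N by [].
  have /eqP sm' := sm; rewrite size_rcons => lt.
  have := h (Ordinal is1) (Tuple sm') lt.
  by apply: filterS => u /=; rewrite cat_rcons.
have /choice[nxt nxtP] (s : seq nat) : exists n : nat,
    good s -> good (rcons s n) /\ forall x, x \in s -> (x < n)%N.
  have [gs|] := pselect (good s); last by exists 0%N.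
  have [n [gn mn]] :=
    filter_ex (filterI (good_next s gs) (Uoo (\max_(x <- s) x)%N)).
  exists n => _; split=> // x xs; apply: leq_ltn_trans mn.
  exact: (@leq_bigmax_seq _ s xpredT id).
pose S := fix S l := if l is l'.+1 then rcons (S l') (nxt (S l')) else [::].
pose a l := nxt (S l).
have SE l : S l = map a (iota 0 l).
  elim: l => // l IH; rewrite -[in RHS]addn1 iotaD map_cat cats1.
  by rewrite -IH.
have gS l : good (S l) by elim: l => //= l /nxtP[].
exists a; split=> [m n mn|i l ls sl il].
  apply: (nxtP (S n) (gS n)).2.
  by rewrite SE map_f// mem_iota.
pose N := (\max_(x <- l) x).+1.
have lN x : x \in l -> (x < N)%N.
  by move=> xl; rewrite ltnS; exact: (@leq_bigmax_seq _ l xpredT id).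
(* A sorted list with entries at least [i] is a subsequence of an interval starting at [i], so
   goodness of a long enough prefix applies to it. *)
have lE : l = [seq x <- iota i (N - i) | x \in l].
  apply: (irr_sorted_eq ltn_trans ltnn) => //.
    by apply: sorted_filter (iota_ltn_sorted _ _); exact: ltn_trans.
  move=> x; rewrite mem_filter mem_iota /=.
  have [xl|//] := boolP (x \in l).
  have ix := allP il x xl; have xN := lN x xl.
  by rewrite ix/= subnKC// (leq_trans ix)// ltnW.
have := gS N i (map a l); rewrite SE -map_drop drop_iota add0n size_map sl leqnn.
rewrite subnn /= cats0; apply=> //.
by rewrite {1}lE map_subseq// filter_subseq.
Qed.

(** Pairs consecutive indices, so that an alternating sum along [double_up js] becomes a sum of
    differences indexed by [js]. *)
Definition double_up (js : seq nat) : seq nat :=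
  flatten [seq [:: j.*2; j.*2.+1] | j <- js].

Section DoubleUp.
Context (T : Type) (a : nat -> T).

Lemma evens_double_up js : evens (map a (double_up js)) = [seq a j.*2 | j <- js].
Proof. by elim: js => //= j js ->. Qed.

Lemma odds_double_up js :
  odds (map a (double_up js)) = [seq a j.*2.+1 | j <- js].
Proof. by elim: js => //= j js ->. Qed.

End DoubleUp.

Lemma size_double_up js : size (double_up js) = (size js).*2.
Proof. by elim: js => //= j js ->. Qed.

Lemma double_up_ge N js : all (leq N) js -> all (leq N.*2) (double_up js).
Proof.
elim: js => //= j js IH /andP[Nj /IH ->].
by rewrite !andbT leq_double Nj/= leqW// leq_double.
Qed.

Lemma double_up_sorted js : sorted ltn js -> sorted ltn (double_up js).
Proof.
rewrite !(sorted_pairwise ltn_trans); elim: js => //= j js IH /andP[jjs /IH ->].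
rewrite ltnS leqnn /= andbT; apply/andP; split.
  have : all (leq j.+1) js by exact: jjs.
  move=> /double_up_ge; apply: sub_all => x; rewrite doubleS => h.
  by apply: leq_trans h; rewrite ltnS leqnSn.
have : all (leq j.+1) js by exact: jjs.
by move=> /double_up_ge; apply: sub_all => x; rewrite doubleS.
Qed.

Lemma frequently_sorted_seq (Q : pred nat) (k N : nat) :
  (forall m, exists2 j, (m <= j)%N & Q j) ->
  exists js, [/\ size js = k, sorted ltn js, all (leq N) js & all Q js].
Proof.
move=> hQ; elim: k N => [|k IH] N; first by exists [::].
have [j Nj Qj] := hQ N; have [js [sk js_s jsj jsQ]] := IH j.+1.
exists (j :: js); split=> /=; first by rewrite sk.
- by rewrite (path_sortedE ltn_trans) js_s andbT.
- by rewrite Nj; apply: sub_all jsj => x /ltnW; apply: leq_trans.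
- by rewrite Qj.
Qed.

(** * Separated sequences *)

Lemma free_ultrafilter : exists U : set_system nat,
  UltraFilter U /\ forall m, U [set n | (m < n)%N].
Proof.
have [U [UU ooU]] := ultraFilterLemma (F := \oo) _.
by exists U; split=> // m; apply: ooU; exact: nbhs_infty_gt.
Qed.

Section SeparatedSequence.
Context {R : realType} (X : normedModType R).

(** Binary expansion on a finite net: [2 *: (v - b i0)] is again in the unit ball, so the process
    repeats. The coefficients are bounded by the geometric sum [2]. *)
Let digits (n : nat) (b : 'I_n -> X) :
  (forall v, `|v| <= 1 -> exists i, `|v - b i| <= 2^-1) ->
  forall m v, `|v| <= 1 -> exists a : 'I_n -> R,
    (forall i, `|a i| <= 2) /\ `|v - \sum_(i < n) a i *: b i| <= 2^-1 ^+ m.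
Proof.
move=> bP; elim=> [|m IH] v v1.
  exists (fun=> 0); split=> [i|]; first by rewrite normr0.
  by rewrite big1 ?subr0// => i _; rewrite scale0r.
have [i0 vi0] := bP v v1.
have [|a [a2 va]] := IH (2 *: (v - b i0)).
  by rewrite normrZ ger0_norm//; lra.
exists (fun i => (i == i0)%:R + 2^-1 * a i); split=> [i|].
  rewrite (le_trans (ler_normD _ _))// normrM (@ger0_norm _ 2^-1)//.
  have := a2 i; have : `|(i == i0)%:R| <= 1 :> R by case: eqP; rewrite ?normr1 ?normr0.
  lra.
have -> : v - \sum_(i < n) ((i == i0)%:R + 2^-1 * a i) *: b i =
    2^-1 *: (2 *: (v - b i0) - \sum_(i < n) a i *: b i).
  under eq_bigr do rewrite scalerDl -scalerA.
  rewrite big_split/= -scaler_sumr (bigD1 i0)//= eqxx scale1r big1 => [|i /negPf ->].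
    by rewrite addr0 opprD addrA scalerBr scalerA mulVf// scale1r.
  by rewrite scale0r.
by rewrite normrZ ger0_norm// exprS ler_wpM2l.
Qed.

(** The sequence is built greedily. If a finite list could not be continued, it would be a [1/2]-net
    of the unit ball, and the ultralimits of the bounded coefficients in [digits] would show that it
    spans [X]. *)
Lemma infinite_dim_separated : infinite_dim X ->
  exists x : nat -> X, (forall n, `|x n| <= 1) /\
    forall m n, (m < n)%N -> 2^-1 <= `|x m - x n|.
Proof.
move=> idX.
have /choice[nxt nxtP] (s : seq X) : exists v, `|v| <= 1 /\
    forall u, u \in s -> 2^-1 <= `|u - v|.
  apply: contrapT => ns; apply: idX; exists (size s), (fun i => nth 0 s i).
  set b := fun i : 'I_(size s) => nth 0 s i.
  have bP v : `|v| <= 1 -> exists i, `|v - b i| <= 2^-1.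
    move=> v1; apply: contrapT => nb; apply: ns; exists v; split=> // u us.
    have iu : (index u s < size s)%N by rewrite index_mem.
    rewrite leNgt; apply/negP => uv; apply: nb; exists (Ordinal iu).
    by rewrite /b/= nth_index// distrC ltW.
  have [U [UU Uoo]] := free_ultrafilter.
  have unit v : `|v| <= 1 -> exists a, v = \sum_(i < size s) a i *: b i.
    move=> v1; have /choice[a aP] := fun m => digits bP m v1.
    have /choice[A AP] (i : 'I_(size s)) : exists l : R, `|l| <= 2 /\
        (fun m => a m i) @ U --> l.
      by apply: ultra_bounded_cvg; apply: filterE => m; exact: (aP m).1.
    exists A; apply/eqP; rewrite -subr_eq0 -normr_le0.
    apply/ler_addgt0Pr => e e0; rewrite add0r.
    pose B : R := \sum_(i < size s) `|b i|.
    have B0 : 0 <= B by exact: sumr_ge0.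
    have e'0 : 0 < e / 2 / (B + 1) by rewrite !divr_gt0// ltr_wpDl.
    have Ua : U [set m | forall i : 'I_(size s),
        `|a m i - A i| <= e / 2 / (B + 1)].
      apply: filter_forall => i.
      exact: (cvg_near_dist (AP i).2 e'0).
    have Um : U [set m | 2^-1 ^+ m <= e / 2 :> R].
      have e20 : 0 < e / 2 by rewrite divr_gt0.
      have h : (2^-1 : R) ^+ m @[m --> \oo] --> (0 : R).
        by apply: cvg_expr; rewrite ger0_norm ?invf_lt1// ltr1n.
      move/cvgrPdist_le: h => /(_ _ e20)[N _ hN].
      apply: filterS (Uoo N) => m /= /ltnW /hN /=.
      by rewrite sub0r normrN ger0_norm// exprn_ge0.
    have [m [/= am em]] := filter_ex (filterI Ua Um).
    have -> : v - \sum_(i < size s) A i *: b i =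
        v - \sum_(i < size s) a m i *: b i +
        \sum_(i < size s) (a m i - A i) *: b i.
      under [X in _ = _ + X]eq_bigr do rewrite scalerBl.
      by rewrite sumrB addrA subrK.
    rewrite (le_trans (ler_normD _ _))// [e]splitr lerD//.
      exact: le_trans (aP m).2 em.
    rewrite (le_trans (ler_norm_sum _ _ _))//.
    have -> : e / 2 = e / 2 / (B + 1) * (B + 1) by rewrite divfK// gt_eqF// ltr_wpDl.
    rewrite (@le_trans _ _ (e / 2 / (B + 1) * B))//.
      rewrite /B mulr_sumr ler_sum// => i _.
      by rewrite normrZ ler_wpM2r.
    by rewrite ler_wpM2l ?(ltW e'0)// lerDl.
  move=> v; have [->|v0] := eqVneq v 0.
    by exists (fun=> 0); rewrite big1// => i _; rewrite scale0r.
  have [|a av] := unit (`|v|^-1 *: v).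
    by rewrite normrZ normfV normr_id mulVf ?normr_eq0.
  exists (fun i => `|v| * a i).
  under eq_bigr do rewrite -scalerA.
  by rewrite -scaler_sumr -av scalerA divff ?normr_eq0// scale1r.
pose S := fix S l := if l is l'.+1 then rcons (S l') (nxt (S l')) else [::].
exists (fun n => nxt (S n)); split=> [n|m n mn]; first exact: (nxtP _).1.
apply: (nxtP (S n)).2.
elim: n mn => // n IH; rewrite ltnS leq_eqVlt /= mem_rcons inE.
by move=> /orP[/eqP -> |/IH ->]; rewrite ?eqxx ?orbT.
Qed.

End SeparatedSequence.

(** If [b < a], take [k] with [k^(a - b) > (B + C) / A]; then
    [A * k^a > (B + C) * k^b >= B * k^b + C]. *)
Lemma power_growth (R : realType) (A C B a b : R) :
  0 < A -> 0 <= C -> 0 <= B -> 0 <= b ->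
  (forall k : nat, (0 < k)%N -> A * k%:R `^ a - C <= B * k%:R `^ b) -> a <= b.
Proof.
move=> A0 C0 B0 b0 h; rewrite leNgt; apply/negP => ba.
pose D := (B + C) / A.
have D0 : 0 <= D by rewrite divr_ge0 ?addr_ge0// ltW.
pose k := (Num.trunc (D `^ (a - b)^-1)).+1.
have kD : D `^ (a - b)^-1 < k%:R by exact: truncnS_gt.
have k1 : 1 <= k%:R :> R by rewrite ler1n.
have := h k isT.
have kb : 1 <= k%:R `^ b :> R by rewrite -[leLHS](powRr0 k%:R) ler_powR.
have -> : a = (a - b) + b by rewrite subrK.
rewrite powRD; last by rewrite pnatr_eq0 implybT.
have Dk : D < k%:R `^ (a - b).
  have ab0 : 0 < a - b by rewrite subr_gt0.
  have DE : D = (D `^ (a - b)^-1) `^ (a - b).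
    by rewrite -powRrM mulVf ?gt_eqF// powRr1.
  rewrite [ltLHS]DE; apply: (gt0_ltr_powR ab0 _ _ kD).
    by rewrite nnegrE powR_ge0.
  by rewrite nnegrE ler0n.
have : D * A = B + C by rewrite divfK// gt_eqF.
move: Dk kb; set u := k%:R `^ (a - b); set w := k%:R `^ b => Dk kb DA.
have : D * A < A * u by rewrite mulrC ltr_pM2l.
have : C <= C * w by rewrite ler_peMr.
move=> h1 h2; have h3 : (B + C) * w < A * u * w by rewrite -DA ltr_pM2r// (lt_le_trans _ kb).
by rewrite mulrA; lra.
Qed.

(** * Compression *)

Section Embedding.
Context {R : realType} (X Y : normedModType R).

Lemma omega_bound (F : X -> Y) (t : R) : (omega F t < +oo)%E ->
  exists2 B : R, 0 < B & forall u v, `|u - v| <= t -> `|F u - F v| <= B.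
Proof.
move=> Ft.
have ub u v : `|u - v| <= t -> ((`|F u - F v|)%:E <= omega F t)%E.
  by move=> uv; apply: ereal_sup_ubound; exists (u, v).
case: (omega F t) Ft ub => [r _ ub|//|_ ub].
  exists (`|r| + 1); first by rewrite ltr_wpDl.
  move=> u v /ub; rewrite lee_fin => /le_trans; apply.
  by rewrite (le_trans (ler_norm r))// lerDl.
by exists 1 => // u v /ub.
Qed.

Lemma rho_le (F : X -> Y) (t : R) u v :
  t <= `|u - v| -> (rho F t <= (`|F u - F v|)%:E)%E.
Proof. by move=> uv; apply: ereal_inf_lbound; exists (u, v). Qed.

End Embedding.

Section AlternatingSums.
Context {R : realType} (X : normedModType R) (x : nat -> X).

Definition alt_sum (t : seq nat) : X :=
  \sum_(n <- evens t) x n - \sum_(n <- odds t) x n.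

Lemma size_evens (T : Type) k (t : seq T) : size t = k.*2 -> size (evens t) = k.
Proof. by elim: k t => [|k IH] [|a [|b t]]//= [] /IH ->. Qed.

Lemma size_odds (T : Type) k (t : seq T) : size t = k.*2 -> size (odds t) = k.
Proof. by elim: k t => [|k IH] [|a [|b t]]//= [] /IH ->. Qed.

Lemma alt_sum_double_up (a : nat -> nat) js :
  alt_sum (map a (double_up js)) =
  \sum_(j <- js) (x (a j.*2) - x (a j.*2.+1)).
Proof.
by rewrite /alt_sum evens_double_up odds_double_up !big_map -sumrB.
Qed.

Context (Y : normedModType R) (U : set_system nat) {UU : UltraFilter U}.
Hypothesis x1 : forall n, `|x n| <= 1.

(** Changing one index moves a sum of the [x n] by at most [2], hence its image by at most a fixed
    [L]; this makes the constant independent of [k]. *)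
Lemma alt_sum_upper (F : X -> Y) (p : R) : 0 < p -> AUS p Y ->
  quasi_reflexive Y -> (forall t : R, 0 < t -> (omega F t < +oo)%E) ->
  exists2 C : R, 0 <= C & forall k, iter_filter U k.*2 [set t |
    `|F (\sum_(n <- evens t) x n) - F (\sum_(n <- odds t) x n)| <=
      C * k%:R `^ p^-1].
Proof.
move=> p0 [c c0 Yc] QR Fomega.
have [L L0 FL] := omega_bound (Fomega 2 (ltr0Sn R 1)).
have C0 : 0 <= 3 * L * expR (c + 2) by rewrite !mulr_ge0 ?expR_ge0// ltW.
exists (3 * L * expR (c + 2)) => // -[|k].
  by rewrite /= !big_nil subrr normr0 mulr_ge0// powR_ge0.
have [M M0 FM] := omega_bound (Fomega k.+1%:R (ltr0Sn R k)).
(* Truncation to [k.+1] entries makes [f] bounded on all sequences; it changes nothing on tuples of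
   the right length. *)
pose f s := F (\sum_(n <- take k.+1 s) x n).
have fM s : `|f s| <= `|F 0| + M.
  rewrite -[f s](subrK (F 0)) addrC (le_trans (ler_normD _ _))// lerD// FM//.
  rewrite subr0 (le_trans (ler_norm_sum _ _ _))//.
  rewrite (@le_trans _ _ (\sum_(n <- take k.+1 s) 1))//; first exact: ler_sum.
  by rewrite big_const_seq count_predT iter_addr_0 ler_nat size_take_min geq_minl.
have fL s n n' t : `|f (s ++ n :: t) - f (s ++ n' :: t)| <= L.
  apply: FL; rewrite !take_cat; case: ifP => _; first by rewrite subrr normr0.
  case: (k.+1 - size s)%N => [|m]; first by rewrite subrr normr0.
  rewrite /= !big_cat/= !big_cons opprD addrACA subrr add0r opprD addrACA subrr addr0.
  by rewrite (le_trans (ler_normB _ _))// (le_trans (lerD (x1 n) (x1 n'))).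
have up := interlaced_upper (UU := UU) (ltW c0) Yc (ltn0Sn k) L0 p0 QR fM fL.
apply: filterS (filterI up (@iter_filter_size U UU k.+1.*2)) => t /= [+ st].
by rewrite /f !take_oversize ?(size_evens st) ?(size_odds st).
Qed.

(** A single tuple satisfying both the lower bound in [X] and the upper bound in [Y] gives
    [A * (k * d)^alpha - C <= B * k^(1/p)], for every [k]. *)
Lemma compression_linear (p alpha d A C : R) (F : X -> Y) :
  0 < p -> AUS p Y -> quasi_reflexive Y ->
  (forall t : R, 0 < t -> (omega F t < +oo)%E) ->
  0 < A -> 0 < C -> 0 < d ->
  (forall t : R, 0 < t -> ((A * t `^ alpha - C)%:E <= rho F t)%E) ->
  (forall k, (0 < k)%N -> iter_filter U k.*2 [set t | k%:R * d <= `|alt_sum t|]) ->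
  alpha <= p^-1.
Proof.
move=> p0 YA QR Fomega A0 C0 d0 Frho xd.
have [B B0 FB] := alt_sum_upper p0 YA QR Fomega.
apply: (@power_growth _ (A * d `^ alpha) C B); rewrite ?(ltW C0) ?invr_ge0 ?(ltW p0)//.
  by rewrite mulr_gt0// powR_gt0.
move=> k k0.
have [t [/= tB td]] := filter_ex (filterI (FB k) (xd k k0)).
have kd : 0 < k%:R * d by rewrite mulr_gt0// ltr0n.
apply: le_trans tB; rewrite -lee_fin.
apply: le_trans (rho_le F td); apply: le_trans (Frho _ kd).
by rewrite lee_fin powRM ?ler0n ?(ltW d0)// -mulrA [d `^ _ * _]mulrC.
Qed.

End AlternatingSums.

(** If [phi (z j)] does not tend to [0], it exceeds some [e] with a fixed sign infinitely often.
    Sums of [k] such terms then have norm at least [k * e / |phi|], against the hypothesis for small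
    [d]. *)
Lemma weakly_null_differences (R : realType) (X : normedModType R)
    (z : nat -> X) :
  (forall d : R, 0 < d -> exists k N, (0 < k)%N /\ forall js,
    size js = k -> sorted ltn js -> all (leq N) js ->
    `|\sum_(j <- js) z j| <= k%:R * d) ->
  weakly_null z.
Proof.
move=> zP phi; apply/cvgrPdist_le => e e0; apply: contrapT => nev.
have [s [s1 hs]] : exists s : R, `|s| = 1 /\
    forall m, exists2 j, (m <= j)%N & e < s * phi (z j).
  apply: contrapT => ns.
  have tail (s : R) : `|s| = 1 ->
      exists N, forall j, (N <= j)%N -> s * phi (z j) <= e.
    move=> s1; apply: contrapT => nN; apply: ns; exists s; split=> // m.
    apply: contrapT => nj; apply: nN; exists m => j mj.
    by rewrite leNgt; apply/negP => h; apply: nj; exists j.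
  have [N1 h1] := tail 1 (normr1 _); have [N2 h2] := tail (-1) (normrN1 _).
  apply: nev; exists (maxn N1 N2) => // j /=; rewrite geq_max => /andP[j1 j2].
  have := h1 j j1; have := h2 j j2; rewrite sub0r normrN ler_norml; lra.
pose d := e / (`|phi| + 1).
have d0 : 0 < d by rewrite divr_gt0// ltr_wpDl.
have [k [N [k0 hk]]] := zP d d0.
have [js [jk jss jN jQ]] :=
  @frequently_sorted_seq (fun j => e < s * phi (z j)) k N hs.
have kR : 0 < k%:R :> R by rewrite ltr0n.
have zs := hk js jk jss jN.
have lo : k%:R * e <= s * phi (\sum_(j <- js) z j).
  rewrite linear_sum mulr_sumr -jk -sum1_size natr_sum mulr_suml.
  rewrite big_seq [leRHS]big_seq ler_sum// => j jjs.
  by rewrite mul1r ltW// (allP jQ).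
have up : s * phi (\sum_(j <- js) z j) <= `|phi| * (k%:R * d).
  rewrite (le_trans (ler_norm _))// normrM s1 mul1r.
  by rewrite (le_trans (dual_normP _ _))// ler_wpM2l// dual_norm_ge0.
have := le_trans lo up; rewrite mulrCA ler_pM2l//.
have de : d * (`|phi| + 1) = e by rewrite divfK// gt_eqF// ltr_wpDl.
nra.
Qed.

(** The bounds valid for most tuples are transferred to all suitable tuples of one subsequence. Its
    successive differences are bounded below by separation and weakly null by smallness, so their
    sums grow like [k^(1/q)], while the images differ by at most [B * k^(1/p)]. *)
Lemma compression_co_Banach_Saks (R : realType) (X Y : normedModType R)
    (U : set_system nat) {UU : UltraFilter U} (x : nat -> X) (F : X -> Y)
    (p q alpha A C : R) :
  (forall m, U [set n | (m < n)%N]) ->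
  0 < p -> 0 < q -> AUS p Y -> quasi_reflexive Y -> co_Banach_Saks q X ->
  (forall t : R, 0 < t -> (omega F t < +oo)%E) ->
  0 < A -> 0 < C ->
  (forall t : R, 0 < t -> ((A * t `^ alpha - C)%:E <= rho F t)%E) ->
  (forall n, `|x n| <= 1) ->
  (forall m n, (m < n)%N -> 2^-1 <= `|x m - x n|) ->
  (forall d : R, 0 < d -> exists2 k, (0 < k)%N &
    iter_filter U k.*2 [set t | `|alt_sum x t| <= k%:R * d]) ->
  alpha <= q / p.
Proof.
move=> Uoo p0 q0 YA QR XB Fomega A0 C0 Frho x1 xsep xsmall.
have [B B0 FB] := alt_sum_upper (UU := UU) x1 p0 YA QR Fomega.
have /choice[kk kkP] (i : nat) : exists k, (0 < k)%N /\
    iter_filter U k.*2 [set t | `|alt_sum x t| <= k%:R * i.+1%:R^-1].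
  by have [|k k0 kP] := xsmall i.+1%:R^-1; [rewrite invr_gt0|exists k].
(* Even indices carry the upper bounds of [FB], odd ones the smallness of the
   alternating sums. *)
pose d i := if odd i then (kk i./2).*2 else i.
pose P i := if odd i
  then [set t | `|alt_sum x t| <= (kk i./2)%:R * i./2.+1%:R^-1]
  else [set t | `|F (\sum_(n <- evens t) x n) - F (\sum_(n <- odds t) x n)| <=
    B * i./2%:R `^ p^-1].
have [|a [a_incr aP]] := @diagonal_subsequence U UU d P Uoo.
  move=> i; rewrite /d /P; case: ifPn => [_|oi]; first exact: (kkP _).2.
  by have := FB i./2; rewrite even_halfK.
pose z j := x (a j.*2) - x (a j.*2.+1).
have z_wn : weakly_null z.
  apply: weakly_null_differences => e e0.
  pose i := Num.trunc e^-1.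
  have ie : i.+1%:R^-1 <= e.
    by rewrite -[leRHS]invrK lef_pV2 ?posrE ?invr_gt0// ltW// truncnS_gt.
  (* Condition number [i.*2.+1] is the smallness for [1/(i + 1) <= e]; it governs only entries at
     least [i.*2.+1], whence the threshold. *)
  exists (kk i), i.*2.+1; split; first exact: (kkP i).1.
  move=> js sj js_s jsN.
  have := aP i.*2.+1 (double_up js) (double_up_sorted js_s).
  rewrite /d /P /= odd_double/= uphalf_double size_double_up sj => /(_ erefl).
  rewrite alt_sum_double_up -/(z _) => h.
  apply: le_trans (h _) _; last by rewrite ler_wpM2l.
  apply: sub_all (double_up_ge jsN) => m; apply: leq_trans.
  by rewrite -[leqRHS]addnn leq_addr.
have z_sn : semi_normalized z.
  exists 2^-1, 2; split; first by rewrite invr_gt0.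
  move=> n; rewrite xsep ?a_incr//=.
  by rewrite (le_trans (ler_normB _ _))// (le_trans (lerD (x1 _) (x1 _))).
have [phi [phi_incr [c c0 cP]]] := XB z z_sn z_wn.
have phi_ge n : (n <= phi n)%N.
  by elim: n => // n IH; apply: leq_ltn_trans IH (phi_incr _ _ _).
have : alpha / q <= p^-1.
  apply: (@power_growth _ (A * c `^ alpha) C B);
    rewrite ?(ltW C0) ?invr_ge0 ?(ltW p0)//.
    by rewrite mulr_gt0// powR_gt0.
  move=> k k0.
  (* Starting at [k] meets the requirement [k <= j_1] of the co-Banach-Saks property. It also makes
     the doubled indices at least [k.*2], the number of the condition on [F] for [k] pairs. *)
  pose js := [seq phi (k + i)%N | i <- iota 0 k].
  have js_s : sorted ltn js.
    rewrite /js (map_comp phi (addn k)) -iotaDl addn0.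
    by apply: homo_sorted (iota_ltn_sorted _ _).
  have jsk : all (leq k) js.
    by apply/allP => _ /mapP[i _ ->]; rewrite (leq_trans _ (phi_ge _))// leq_addr.
  have := aP k.*2 (double_up js) (double_up_sorted js_s).
  rewrite /d /P odd_double/= size_double_up size_map size_iota => /(_ erefl).
  move=> /(_ (double_up_ge jsk)); rewrite doubleK => up.
  apply: le_trans up.
  have ck : 0 < c * k%:R `^ q^-1 by rewrite mulr_gt0// powR_gt0// ltr0n.
  have lo := cP k (fun i : 'I_k => (k + i)%N) _ (fun i => leq_addr i k).
  have {}lo : c * k%:R `^ q^-1 <= `|alt_sum x (map a (double_up js))|.
    rewrite alt_sum_double_up big_map -{2}[k]subn0 -/(index_iota 0 k).
    rewrite big_mkord; apply: lo => i j ij; by rewrite ltn_add2l.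
  rewrite -lee_fin; apply: le_trans (rho_le F lo); apply: le_trans (Frho _ ck).
  rewrite lee_fin powRM ?powR_ge0 ?(ltW c0)// -powRrM [q^-1 * _]mulrC.
  by rewrite mulrA.
by rewrite ler_pdivrMr// mulrC.
Qed.

(** * Unit vectors of [ell1] and copies of [ell1] *)

Lemma unit_vector_series_cvg (R : realType) (n : nat) :
  series (fun i => `|(i == n)%:R : R|) m @[m --> \oo] --> (1 : R).
Proof.
apply: cvg_near_cst; exists n.+1 => // m /= nm; rewrite /series/=.
rewrite (bigD1_seq n) ?mem_index_iota ?iota_uniq//=.
rewrite eqxx normr1 big1 ?addr0// => i /negPf ->; exact: normr0.
Qed.

Lemma unit_vector_subproof (R : realType) (n : nat) :
  (fun i => (i == n)%:R : R^o) \in @summable_seq R.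
Proof. by apply/summable_seqP; apply: cvgP; exact: unit_vector_series_cvg. Qed.

Definition unit_vector (R : realType) (n : nat) : ell1 R :=
  Ell1 (unit_vector_subproof R n).

Lemma perm_evens_odds (T : eqType) k (t : seq T) : size t = k.*2 ->
  perm_eq (evens t ++ odds t) t.
Proof.
elim: k t => [|k IH] [|a [|b t]]//= [] /IH h.
by rewrite perm_cons -cat1s perm_catCA /= perm_cons.
Qed.

Section Ell1Copies.
Context {R : realType}.

Lemma norm_unit_vector n : `|unit_vector R n| = 1.
Proof. by apply: cvg_lim => //; exact: unit_vector_series_cvg. Qed.

(** Distinct indices exclude cancellation, so the coordinates in [evens t] alone contribute [k]. *)
Lemma norm_alt_sum_unit_vector k t : uniq t -> size t = k.*2 ->
  k%:R <= `|alt_sum (unit_vector R) t|.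
Proof.
move=> ut st; set u := alt_sum _ t.
have := ut; rewrite -(perm_uniq (perm_evens_odds st)) cat_uniq.
move=> /and3P[ue /hasPn eo _].
have coordE i (s : seq nat) :
    (\sum_(n <- s) unit_vector R n) i = (count_mem i s)%:R.
  elim: s => [|n s IH]; first by rewrite big_nil.
  rewrite big_cons -[LHS]/(unit_vector R n i + (\sum_(n <- s) unit_vector R n) i).
  by rewrite IH /= eq_sym natrD.
have u1 i : i \in evens t -> `|u i| = 1.
  move=> ie; rewrite -[u i]/((\sum_(n <- evens t) unit_vector R n) i -
    (\sum_(n <- odds t) unit_vector R n) i).
  rewrite !coordE (count_uniq_mem _ ue) ie (count_memPn _) ?subr0 ?normr1//.
  by apply/negP => /eo; rewrite ie.
pose N := (\max_(x <- evens t) x).+1.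
have nd : nondecreasing_seq (series (fun n => `|u n|)).
  by apply/nondecreasing_series => ? _ _.
apply: le_trans (nondecreasing_cvgn_le nd (@ell1_cvg _ u) N).
rewrite /series/= (bigID (mem (evens t)))/=.
rewrite -[leLHS]addr0 lerD ?sumr_ge0//.
under eq_bigr do rewrite u1//.
rewrite big_const_seq iter_addr_0 -size_filter ler_nat -(size_evens st).
apply: uniq_leq_size ue _ => i ie.
rewrite mem_filter ie mem_index_iota /= ltnS.
exact: (@leq_bigmax_seq _ (evens t) xpredT id).
Qed.

Lemma contains_ell1_sequence (X : normedModType R) : contains_ell1 X ->
  exists (x : nat -> X) (d : R), [/\ 0 < d, forall n, `|x n| <= 1 &
    forall k t, uniq t -> size t = k.*2 -> k%:R * d <= `|alt_sum x t|].
Proof.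
move=> [T [a [b [a0 Tab]]]].
have b0 : 0 < b.
  by have /andP[h1 h2] := Tab (unit_vector R 0); move: (le_trans h1 h2);
    rewrite norm_unit_vector !mulr1; exact: lt_le_trans.
exists (fun n => b^-1 *: T (unit_vector R n)), (a / b); split.
- by rewrite divr_gt0.
- move=> n; rewrite normrZ gtr0_norm ?invr_gt0// ler_pdivrMl// mulr1.
  by have /andP[_] := Tab (unit_vector R n); rewrite norm_unit_vector mulr1.
- move=> k t ut st.
  have -> : alt_sum (fun n => b^-1 *: T (unit_vector R n)) t =
      b^-1 *: T (alt_sum (unit_vector R) t).
    by rewrite /alt_sum linearB scalerBr !linear_sum.
  rewrite normrZ gtr0_norm ?invr_gt0// mulrA ler_pdivrMr// mulrAC mulVf ?gt_eqF//.
  rewrite mul1r; have /andP[h _] := Tab (alt_sum (unit_vector R) t).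
  by rewrite (le_trans _ h)// mulrC ler_wpM2l ?(ltW a0)// norm_alt_sum_unit_vector.
Qed.

End Ell1Copies.

(** * Bounds on the compression exponent *)

Section CompressionBounds.
Context {R : realType} (X Y : normedModType R) (p q alpha A C : R) (F : X -> Y).
Hypotheses (p0 : 0 < p) (YA : AUS p Y) (QR : quasi_reflexive Y)
  (Fomega : forall t : R, 0 < t -> (omega F t < +oo)%E) (A0 : 0 < A) (C0 : 0 < C)
  (Frho : forall t : R, 0 < t -> ((A * t `^ alpha - C)%:E <= rho F t)%E).

Lemma compression_contains_ell1 : contains_ell1 X -> alpha <= p^-1.
Proof.
move=> /contains_ell1_sequence[x [d [d0 x1 xd]]].
have [U [UU Uoo]] := free_ultrafilter.
apply: (compression_linear (UU := UU) x1 p0 YA QR Fomega A0 C0 d0 Frho).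
move=> k k0; apply: filterS (filterI (@iter_filter_uniq U UU k.*2 Uoo)
  (@iter_filter_size U UU k.*2)).
by move=> t [/= ut st]; exact: xd.
Qed.

Lemma compression_infinite_dim : 1 < q -> infinite_dim X ->
  co_Banach_Saks q X -> alpha <= q / p.
Proof.
move=> q1 /infinite_dim_separated[x [x1 xsep]] XB.
have [U [UU Uoo]] := free_ultrafilter.
have q0 : 0 < q by exact: lt_trans q1.
have [[d [d0 xd]]|xsmall] := pselect (exists d : R, 0 < d /\
    forall k, (0 < k)%N ->
      iter_filter U k.*2 [set t | k%:R * d <= `|alt_sum x t|]).
  apply: (@le_trans _ _ p^-1); last by rewrite ler_peMl ?invr_ge0 ?ltW.
  exact: (compression_linear (UU := UU) x1 p0 YA QR Fomega A0 C0 d0 Frho).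
apply: (compression_co_Banach_Saks (UU := UU) Uoo p0 q0 YA QR XB Fomega A0 C0
  Frho x1 xsep) => d d0.
(* If no [k] gave small sums for this [d], the ultrafilter would make most sums exceed [k * d] for
   every [k], which is the excluded case. *)
apply: contrapT => nk; apply: xsmall; exists d; split=> // k k0.
have [h|] := in_ultra_setVsetC [set t | `|alt_sum x t| <= k%:R * d]
  (iter_filter_ultra (U := U) k.*2); first by case: nk; exists k.
by apply: filterS => t /= /negP; rewrite -ltNge => /ltW.
Qed.

End CompressionBounds.

Theorem theorem3p5 (R : realType) (p q : R) (X Y : completeNormedModType R)
    (q_gt1 : 1 < q) (q_lt_p : q < p)
    (X_infinite_dim : infinite_dim X) (X_co_Banach_Saks : co_Banach_Saks q X)
    (Y_AUS : AUS p Y) (Y_quasi_reflexive : quasi_reflexive Y) :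
  [/\ ~ coarse_Lipschitz_embeds X Y,
      contains_ell1 X -> compression_exponent X Y <= p^-1
    & ~ contains_ell1 X -> compression_exponent X Y <= q / p].
Proof.
have p0 : 0 < p by rewrite (lt_trans _ q_lt_p)// (lt_trans _ q_gt1).
have q0 : 0 < q by exact: lt_trans q_gt1.
have exponent_le (r : R) : 0 <= r ->
    (forall alpha, compression_set X Y alpha -> alpha <= r) ->
    compression_exponent X Y <= r.
  move=> r0 h; rewrite /compression_exponent.
  have [->|/set0P S0] := eqVneq (compression_set X Y) set0; first by rewrite sup0.
  exact: ge_sup.
split.
- move=> [F [A [B [C [D [A0 B0 C0 D0 FP]]]]]].
  have Fomega (t : R) : 0 < t -> (omega F t < +oo)%E.
    by move=> t0; apply: le_lt_trans (FP t t0).1 (ltry _).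
  (* A coarse Lipschitz embedding satisfies the lower bound with exponent [1]. This value is outside
     [compression_set], so the bound on [alpha] is applied directly to [F] and yields
     [1 <= q / p]. *)
  have Frho (t : R) : 0 < t -> ((A * t `^ 1 - C)%:E <= rho F t)%E.
    by move=> t0; rewrite powRr1 ?(ltW t0)//; exact: (FP t t0).2.
  have := compression_infinite_dim p0 Y_AUS Y_quasi_reflexive Fomega A0 C0 Frho
    q_gt1 X_infinite_dim X_co_Banach_Saks.
  by rewrite ler_pdivlMr// mul1r leNgt q_lt_p.
- move=> Xl1; apply: exponent_le; first by rewrite invr_ge0 ltW.
  move=> alpha [_ [F [[_ Fomega] [A [C [A0 C0 Frho]]]]]].
  exact: (compression_contains_ell1 p0 Y_AUS Y_quasi_reflexive Fomega A0 C0 Frho).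
- move=> _; apply: exponent_le; first by rewrite divr_ge0 ?ltW.
  move=> alpha [_ [F [[_ Fomega] [A [C [A0 C0 Frho]]]]]].
  exact: (compression_infinite_dim p0 Y_AUS Y_quasi_reflexive Fomega A0 C0 Frho
    q_gt1 X_infinite_dim X_co_Banach_Saks).
Qed.
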